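(* Let $K\ge1$ be an integer and $\sigma\in(0,1)$, both arbitrary. Then the iterates $(x_k)$ of the algorithm APPROX+restart with parameters $K$ and $\sigma$ (as defined in the context) satisfy, for any $k\ge K$, $$\mathbf{E}[\Delta(x_k)]\le\left(\max\left(\sigma,\,1-\sigma m_K(\mu_F(v))\right)^{1/K}\right)^{k-K}\Delta(x_0).$$
   Context: Problem: $f:\mathbb{R}^n\to\mathbb{R}$ is convex and differentiable; $\psi(x)=\sum_{i=1}^n\psi^i(x^i)$ where each $\psi^i:\mathbb{R}\to\mathbb{R}\cup\{+\infty\}$ is closed and convex; $F=f+\psi$; $x_*$ is a minimizer of $F$; $\operatorname{dom}\psi=\{x:\psi(x)<+\infty\}$. For a vector $v$ with positive entries, $\|x\|_v^2=\sum_{i=1}^n v_i(x^i)^2$. Strong convexity assumption: $\mu_F(v)>0$ is a constant such that $F(x)\ge F(x_* )+\frac{\mu_F(v)}{2}\|x-x_*\|_v^2$ for all $x\in\mathbb{R}^n$. Sampling: $\hat S$ is a random subset of $\{1,\dots,n\}$ with $\mathbf{P}(i\in\hat S)=\mathbf{P}(j\in\hat S)$ for all $i,j$, and $\tau=\mathbf{E}[|\hat S|]>0$. ESO assumption: for all $x,h\in\mathbb{R}^n$, $\mathbf{E}[f(x+h_{[\hat S]})]\le f(x)+\frac{\tau}{n}\left(\langle\nabla f(x),h\rangle+\frac12\|h\|_v^2\right)$, where $h_{[S]}=\sum_{i\in S}h^ie_i$ and $e_i$ is the $i$th standard basis vector. Reference sequence and coefficients: $\vartheta_0=\theta_0=\tau/n$,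 $\vartheta_{j+1}=\frac{\sqrt{\vartheta_j^4+4\vartheta_j^2}-\vartheta_j^2}{2}$, and $\frac{1}{\vartheta_{-1}^2}:=\frac{1-\vartheta_0}{\vartheta_0^2}$. Set $\gamma_0^0=1$, $\gamma_1^0=0$, $\gamma_1^1=1$, and for $j\ge1$: $\gamma_{j+1}^i=(1-\vartheta_j)\gamma_j^i$ for $i=0,\dots,j-1$; $\gamma_{j+1}^j=\vartheta_j(1-\frac n\tau\vartheta_{j-1})+\frac n\tau(\vartheta_{j-1}-\vartheta_j)$; $\gamma_{j+1}^{j+1}=\frac n\tau\vartheta_j$. For $j\ge1$ let $W_j=\sum_{i=0}^{j-1}\frac{\gamma_j^i}{\vartheta_{i-1}^2}+\frac{1}{\vartheta_0\vartheta_{j-1}}-\frac{1-\vartheta_0}{\vartheta_0^2}$ and $m_j(\mu)=\frac{\mu\theta_0^2}{1+\mu(1-\theta_0)}W_j$. Also $\Delta(x)=\frac{1-\theta_0}{\theta_0^2}(F(x)-F(x_* ))+\frac{1}{2\theta_0^2}\|x-x_*\|_v^2$. Algorithm APPROX+restart (parameters $K\ge1$ integer, $\sigma\in(0,1)$): choose $x_0\in\operatorname{dom}\psi$, $z_0=x_0$, $\theta_0=\tau/n$, last restart index $s=0$. For $k=0,1,2,\dots$: (1) $y_k=(1-\theta_k)x_k+\theta_kz_k$; (2) draw $S_k\sim\hat S$ independently of the past; for $i\in S_k$ set $z_{k+1}^i=\arg\min_{z\in\mathbb{R}}\{\langle\nabla_if(y_k),z-y_k^i\rangle+\frac{\theta_knv_i}{2\tau}|z-z_k^i|^2+\psi^i(z)\}$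 ($\nabla_i f$ is the $i$th partial derivative), and $z_{k+1}^i=z_k^i$ for $i\notin S_k$; (3) $x_{k+1}=y_k+\frac n\tau\theta_k(z_{k+1}-z_k)$; (4) $\theta_{k+1}=\frac{\sqrt{\theta_k^4+4\theta_k^2}-\theta_k^2}{2}$; (5) if $k\equiv0\bmod K$, restart: with $j=k+1-s$ (number of iterations since the last restart) put $\mathring x_{k+1}=\frac{1}{W_j}\left(\sum_{i=0}^{j-1}\frac{\gamma_j^i}{\vartheta_{i-1}^2}x_{s+i}+\left(\frac{1}{\vartheta_0\vartheta_{j-1}}-\frac{1-\vartheta_0}{\vartheta_0^2}\right)x_{k+1}\right)$ and $\bar x_{k+1}=\sigma x_{k+1}+(1-\sigma)\mathring x_{k+1}$, then replace $x_{k+1}\leftarrow\bar x_{k+1}$, $z_{k+1}\leftarrow\bar x_{k+1}$, $\theta_{k+1}\leftarrow\theta_0$, $s\leftarrow k+1$. The iterate $x_k$ denotes the value after any such replacement. *)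

(* Defs.v *)
From HB Require Import structures.
From mathcomp Require Import all_boot all_order all_algebra finmap.
From mathcomp Require Import all_classical all_reals all_analysis.

Set Implicit Arguments.
Unset Strict Implicit.
Unset Printing Implicit Defensive.

Import Order.TTheory GRing.Theory Num.Theory.
Import numFieldNormedType.Exports.

Local Open Scope classical_set_scope.
Local Open Scope ring_scope.

(* Subsets of a finite type carry the discrete sigma-algebra, so that random   *)
(* subsets are random variables in the sense of the library.                   *)
HB.instance Definition _ (T : finType) := isPointed.Build {set T} finset.set0.
HB.instance Definition _ (T : finType) :=
  @isMeasurable.Build default_measure_display {set T}
    discrete_measurable discrete_measurable0
    discrete_measurableC discrete_measurableU.

Section probability.
Context {R : realType}.

Definition mutually_independent {d d'} {T : measurableType d}
    {T' : measurableType d'} (P : probability T R)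
    (X : nat -> {RV P >-> T'}) : Prop :=
  forall (J : {fset nat}) (B : nat -> set T'),
    (forall j, j \in J -> measurable (B j)) ->
    P (\bigcap_(j in [set` J]) (X j @^-1` B j)) =
    (\prod_(j <- J) P (X j @^-1` B j))%E.

Definition same_law {d1 d2 d'} {T1 : measurableType d1} {T2 : measurableType d2}
    {T' : measurableType d'} (P1 : probability T1 R) (P2 : probability T2 R)
    (X1 : {RV P1 >-> T'}) (X2 : {RV P2 >-> T'}) : Prop :=
  forall A : set T', measurable A ->
    distribution P1 X1 A = distribution P2 X2 A.

End probability.

Section convex_analysis.
Context {R : realType}.

Definition epigraph (g : R -> \bar R) : set (R^o * R^o) :=
  [set p | (g p.1 <= p.2%:E)%E].

Definition closed_convex (g : R -> \bar R) : Prop :=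
  closed (epigraph g) /\ convex_set (epigraph g).

Definition is_argmin (g : R -> \bar R) (u : R) : Prop :=
  forall w, (g u <= g w)%E.

End convex_analysis.

Section objective.
Context {R : realType} {n : nat}.
Implicit Types (f : 'rV[R]_n -> R) (psi : 'I_n -> R -> \bar R).
Implicit Types (v x y h : 'rV[R]_n).

Definition separable psi x : \bar R := (\sum_(i < n) psi i (x ord0 i))%E.

Definition dom psi : set 'rV[R]_n := [set x | (separable psi x < +oo)%E].

Definition objective f psi x : \bar R := ((f x)%:E + separable psi x)%E.

Definition is_minimizer (F : 'rV[R]_n -> \bar R) x : Prop :=
  forall y, (F x <= F y)%E.

Definition wnorm2 v x : R := \sum_(i < n) v ord0 i * x ord0 i ^+ 2.

Definition strongly_convex_at (F : 'rV[R]_n -> \bar R) v (mu : R) xs : Prop :=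
  forall x, (F xs + (mu / 2 * wnorm2 v (x - xs))%:E <= F x)%E.

Definition partial_derivative f (i : 'I_n) x : R := 'D_(delta_mx ord0 i) f x.

Definition coord_restrict (S : {set 'I_n}) h : 'rV[R]_n :=
  \row_(i < n) (if i \in S then h ord0 i else 0).

Definition uniform_sampling {d} {T : measurableType d} (P : probability T R)
    (S : {RV P >-> {set 'I_n}}) : Prop :=
  forall i j : 'I_n, P [set w | i \in S w] = P [set w | j \in S w].

Definition eso {d} {T : measurableType d} (P : probability T R)
    (S : {RV P >-> {set 'I_n}}) f (tau : R) v : Prop :=
  forall x h,
    ('E_P[fun w => (f (x + coord_restrict (S w) h))%R] <=
     (f x + tau / n%:R *
        (\sum_(i < n) partial_derivative f i x * h ord0 i + 2^-1 * wnorm2 v h))%:E)%E.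

End objective.

Section approx_restart.
Context {R : realType} (n : nat) (tau : R).

Definition theta0 : R := tau / n%:R.

Definition next_theta (t : R) : R :=
  (Num.sqrt (t ^+ 4 + 4 * t ^+ 2) - t ^+ 2) / 2.

Definition vartheta (j : nat) : R := iter j next_theta theta0.

(* inv_prev2 i is 1 / vartheta_(i-1) ^ 2, with the convention                  *)
(* 1 / vartheta_(-1) ^ 2 = (1 - vartheta_0) / vartheta_0 ^ 2                   *)
Definition inv_prev2 (i : nat) : R :=
  if i is i'.+1 then (vartheta i' ^+ 2)^-1
  else (1 - vartheta 0%N) / vartheta 0%N ^+ 2.

(* gamma j i is the coefficient with lower index j and upper index i; it is 0  *)
(* for i > j, where the coefficient is not defined.                            *)
Fixpoint gamma (j i : nat) : R :=
  match j with
  | 0 => (i == 0%N)%:R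
  | 1 => (i == 1%N)%:R
  | (j'.+1 as l).+1 =>
      if (i < l)%N then (1 - vartheta l) * gamma l i
      else if i == l then
        vartheta l * (1 - n%:R / tau * vartheta j') +
        n%:R / tau * (vartheta j' - vartheta l)
      else if i == l.+1 then n%:R / tau * vartheta l
      else 0
  end.

(* Weight of the last iterate in the restart average; only used for j >= 1.    *)
Definition last_weight (j : nat) : R :=
  (vartheta 0%N * vartheta j.-1)^-1 - (1 - vartheta 0%N) / vartheta 0%N ^+ 2.

Definition W_coef (j : nat) : R :=
  \sum_(i < j) gamma j i * inv_prev2 i + last_weight j.

Definition m_coef (j : nat) (mu : R) : R :=
  mu * theta0 ^+ 2 / (1 + mu * (1 - theta0)) * W_coef j.

Definition Delta (F : 'rV[R]_n -> \bar R) (v xs x : 'rV[R]_n) : \bar R :=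
  (((1 - theta0) / theta0 ^+ 2)%:E * (F x - F xs) +
   ((2 * theta0 ^+ 2)^-1 * wnorm2 v (x - xs))%:E)%E.

Section run.
Variables (K : nat) (sigma : R).

(* Values of theta_k and of the last restart index s at the beginning of       *)
(* iteration k.                                                                *)
Fixpoint theta (k : nat) : R :=
  if k is k'.+1 then
    if (K %| k')%N then theta0 else next_theta (theta k')
  else theta0.

Fixpoint last_restart (k : nat) : nat :=
  if k is k'.+1 then
    if (K %| k')%N then k else last_restart k'
  else 0%N.

Variables (f : 'rV[R]_n -> R) (psi : 'I_n -> R -> \bar R) (v : 'rV[R]_n).

Definition extrapolate (k : nat) (xk zk : 'rV[R]_n) : 'rV[R]_n :=
  (1 - theta k) *: xk + theta k *: zk.

Definition coord_model (k : nat) (i : 'I_n) (yk zk : 'rV[R]_n) (u : R)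
    : \bar R :=
  ((partial_derivative f i yk * (u - yk ord0 i) +
    theta k * n%:R * v ord0 i / (2 * tau) * `|u - zk ord0 i| ^+ 2)%:E +
   psi i u)%E.

(* The restart point built at the end of iteration k from the iterates         *)
(* x_s, ..., x_k and from the value xnew of x_(k+1) before its replacement.    *)
Definition average_point (x : nat -> 'rV[R]_n) (k : nat) (xnew : 'rV[R]_n)
    : 'rV[R]_n :=
  let s := last_restart k in
  let j := (k.+1 - s)%N in
  (W_coef j)^-1 *: (\sum_(i < j) (gamma j i * inv_prev2 i) *: x (s + i)%N +
                    last_weight j *: xnew).

Definition restart_point (x : nat -> 'rV[R]_n) (k : nat) (xnew : 'rV[R]_n)
    : 'rV[R]_n :=
  sigma *: xnew + (1 - sigma) *: average_point x k xnew.

(* x and z are the iterates, after any replacement, of a run of the algorithm  *)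
(* started at x0 in which the sampled sets are S 0, S 1, ...; znew and xnew    *)
(* are the values of z_(k+1) and x_(k+1) before any replacement.               *)
Definition approx_restart_run (x0 : 'rV[R]_n) (S : nat -> {set 'I_n})
    (x z : nat -> 'rV[R]_n) : Prop :=
  [/\ x 0%N = x0, z 0%N = x0 &
   forall k, exists znew : 'rV[R]_n,
     let yk := extrapolate k (x k) (z k) in
     let xnew := yk + (n%:R / tau * theta k) *: (znew - z k) in
     [/\ forall i, i \in S k ->
           is_argmin (coord_model k i yk (z k)) (znew ord0 i),
         forall i, i \notin S k -> znew ord0 i = z k ord0 i,
         x k.+1 = (if (K %| k)%N then restart_point x k xnew else xnew) &
         z k.+1 = (if (K %| k)%N then restart_point x k xnew else znew)]].

End run.

End approx_restart.

(* Main.v *)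
Require Import Defs.
From HB Require Import structures.
From mathcomp Require Import all_boot all_order all_algebra finmap.
From mathcomp Require Import all_classical all_reals all_analysis.
From mathcomp Require Import ring lra zify.

Set Implicit Arguments.
Unset Strict Implicit.
Unset Printing Implicit Defensive.

Import Order.TTheory GRing.Theory Num.Theory.
Import numFieldNormedType.Exports.

Local Open Scope classical_set_scope.
Local Open Scope ring_scope.

(* Inside an epoch, [x_j] is the convex combination of [z_0, ..., z_j] with
   weights [gamma j i].  The three-point inequality for the coordinate
   minimisations and the ESO make
     inv_prev2 i * (f x_i + sum_l gamma i l * psi z_l - F xs)
       + |z_i - xs|^2_v / (2 theta0^2)
   a supermartingale.  Averaging it over [i] with weights [gamma j i] and using
   convexity gives E[Delta x_j] + W_j E[F avg - F xs] <= E[Delta x_0] for the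
   averaged point, hence E[Delta x_j] + m_j E[Delta avg] <= E[Delta x_0] by
   strong convexity, while E[Delta avg] <= E[Delta x_0] by convexity.  A convex
   combination of these two bounds is the contraction at a restart.

   Since minimisers are unique, the state after [k] steps is a function of the
   [k] sets drawn so far, so all expectations are finite sums.  Only draws of
   positive probability matter, and these occur in actual runs: the existence
   of the minimisers need not be proved. *)

(** * Step sizes and averaging weights *)

Section coefficients.
Context {R : realType} (n : nat) (tau : R).
Hypothesis theta0_gt0 : 0 < theta0 n tau.
Hypothesis theta0_le1 : theta0 n tau <= 1.

Local Notation th0 := (theta0 n tau).
Local Notation vth := (vartheta n tau).
Local Notation g := (gamma n tau).

Lemma theta0V : n%:R / tau = th0^-1.
Proof. by rewrite /theta0 invf_div. Qed.

Lemma next_theta_gt0 (t : R) : 0 < t -> 0 < next_theta t.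
Proof.
move=> t0; rewrite /next_theta divr_gt0// subr_gt0.
have t2 : 0 <= t ^+ 2 by rewrite exprn_ge0// ltW.
have h : Num.sqrt ((t ^+ 2) ^+ 2) = t ^+ 2 by rewrite sqrtr_sqr ger0_norm.
rewrite -[X in X < _]h ltr_sqrt.
  by rewrite -exprM ltrDl mulr_gt0// exprn_gt0.
by rewrite addr_gt0// ?mulr_gt0// exprn_gt0.
Qed.

(** For [t > 0], [next_theta t] is the positive root of [u ^+ 2 + t ^+ 2 * u - t ^+ 2]. Monotonicity
    and the closed form of [inv_prev2] both rest on this equation. *)
Lemma next_theta_sqr (t : R) : next_theta t ^+ 2 = (1 - next_theta t) * t ^+ 2.
Proof.
rewrite /next_theta.
have : Num.sqrt (t ^+ 4 + 4 * t ^+ 2) ^+ 2 = t ^+ 4 + 4 * t ^+ 2.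
  by rewrite sqr_sqrtr//; have := sqr_ge0 (t ^+ 2); have := sqr_ge0 t; rewrite -exprM; lra.
move: (Num.sqrt _) => s hs; rewrite expr_div_n sqrrB hs; by field.
Qed.

Lemma next_theta_le (t : R) : 0 < t -> next_theta t <= t.
Proof.
move=> t0; have u0 := next_theta_gt0 t0.
have : next_theta t ^+ 2 <= t ^+ 2.
  rewrite next_theta_sqr mulrBl mul1r lerBlDr lerDl mulr_ge0 ?exprn_ge0 ?ltW//.
by rewrite ler_pXn2r// nnegrE ltW.
Qed.

Lemma vartheta_gt0 j : 0 < vth j.
Proof. by elim: j => //= j ih; apply: next_theta_gt0. Qed.

Lemma vartheta_decr j : vth j.+1 <= vth j.
Proof. exact/next_theta_le/vartheta_gt0. Qed.

Lemma vartheta_le j : vth j <= th0.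
Proof. by elim: j => // j; apply: le_trans; apply: vartheta_decr. Qed.

Lemma vartheta_le1 j : vth j <= 1.
Proof. exact: le_trans (vartheta_le j) _. Qed.

(** The convention at index 0 is this formula; at later indices it is the quadratic equation of
    [next_theta]. So the factor of the old gap in [approx_step_descent] is the weight left by the
    preceding step. *)
Lemma inv_prev2E j : inv_prev2 n tau j = (1 - vth j) / vth j ^+ 2.
Proof.
case: j => //= j; rewrite -/(vth j) next_theta_sqr.
have t0 := vartheta_gt0 j; have t1 := vartheta_gt0 j.+1.
rewrite /= -/(vth j) in t1.
have : (1 - next_theta (vth j)) * vth j ^+ 2 != 0.
  by rewrite -next_theta_sqr expf_neq0// gt_eqF.
rewrite mulf_eq0 negb_or => /andP[h1 h2].
by field; rewrite h1 gt_eqF.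
Qed.

Lemma inv_prev2_ge0 j : 0 <= inv_prev2 n tau j.
Proof.
by rewrite inv_prev2E divr_ge0 ?subr_ge0 ?vartheta_le1// exprn_ge0// ltW// vartheta_gt0.
Qed.

Local Arguments gamma : simpl never.

Lemma gammaSS j i : g j.+2 i =
  if (i < j.+1)%N then (1 - vth j.+1) * g j.+1 i
  else if i == j.+1 then
    vth j.+1 * (1 - n%:R / tau * vth j) + n%:R / tau * (vth j - vth j.+1)
  else if i == j.+2 then n%:R / tau * vth j.+1 else 0.
Proof. by []. Qed.

Lemma gamma_diag j : g j.+1 j.+1 = n%:R / tau * vth j.
Proof.
case: j => [|j]; last by rewrite gammaSS ltnNge leqW//= gtn_eqF// eqxx.
by rewrite /gamma /vartheta /= theta0V mulVf// gt_eqF.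
Qed.

(** In the entry next to the diagonal, both summands are nonnegative because the step sizes decrease
    and stay below [theta0]. *)
Lemma gamma_ge0 j i : 0 <= g j i.
Proof.
case: j => [|j]; first by rewrite /gamma ler0n.
elim: j i => [|j ih] i; first by rewrite /gamma ler0n.
rewrite gammaSS theta0V.
case: ifP => _; first by rewrite mulr_ge0// subr_ge0 vartheta_le1.
have h := vartheta_gt0 j.+1.
have h0 : 0 <= th0^-1 by rewrite invr_ge0 ltW.
case: ifP => _.
  rewrite addr_ge0// mulr_ge0 ?(ltW h)// ?subr_ge0 ?vartheta_decr//.
  by rewrite mulrC ler_pdivrMr// mul1r vartheta_le.
by case: ifP => _ //; rewrite mulr_ge0 ?(ltW h).
Qed.

(** With [a i = z_i] the right side is the update of [x]. A general module allows the same recursion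
    for the points [z_i], for the psi-values at them and for the constant 1. *)
Lemma gamma_rec (V : lmodType R) (a : nat -> V) j :
  \sum_(i < j.+2) g j.+1 i *: a i =
  (1 - vth j) *: (\sum_(i < j.+1) g j i *: a i) +
  (n%:R / tau * vth j) *: a j.+1 + (vth j - n%:R / tau * vth j) *: a j.
Proof.
case: j => [|j].
  rewrite !big_ord_recr !big_ord0 /gamma /vartheta /= !add0r theta0V mulVf ?gt_eqF//.
  by rewrite scale0r add0r !scale1r addrAC -scalerDl addrA subrK subrr scale0r add0r.
rewrite big_ord_recr /= gamma_diag [in LHS]big_ord_recr /=.
rewrite [in RHS]big_ord_recr /= gamma_diag.
rewrite gammaSS ltnn eqxx.
under eq_bigr => i _ do rewrite gammaSS ltn_ord -scalerA.
rewrite -scaler_sumr scalerDr -!addrA; congr (_ + _).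
rewrite [in RHS]addrCA [LHS]addrC; congr (_ + _).
by rewrite scalerA -scalerDl -[next_theta _]/(vth j.+1); congr (_ *: _); ring.
Qed.

Lemma gamma_sum1 j : \sum_(i < j.+1) g j i = 1.
Proof.
elim: j => [|j ih]; first by rewrite big_ord_recr big_ord0 /gamma /= add0r.
have one (k m : nat) : \sum_(i < k) g m i = \sum_(i < k) g m i *: (1 : R^o).
  by apply: eq_bigr => i _; rewrite /GRing.scale /= mulr1.
by rewrite one (gamma_rec (fun=> 1 : R^o)) -one ih /GRing.scale /= !mulr1; ring.
Qed.

(** As [vth j.-1 <= th0], the first term is at least [1 / th0 ^ 2], which exceeds
    [(1 - th0) / th0 ^ 2]. *)
Lemma last_weight_gt0 j : 0 < last_weight n tau j.
Proof.
rewrite /last_weight; have := vartheta_gt0 j.-1; have := vartheta_le j.-1.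
rewrite -[vth 0]/th0; move: (vth _) => t t1 t0.
rewrite subr_gt0 (@lt_le_trans _ _ ((th0 * th0)^-1))//.
  rewrite -expr2 ltr_pdivrMr ?exprn_gt0// mulVf ?expf_neq0 ?gt_eqF//.
  by rewrite ltrBlDr ltrDl.
by rewrite lef_pV2 ?posrE; [exact: ler_wpM2l (ltW theta0_gt0) _ _ t1 | exact: mulr_gt0..].
Qed.

Lemma W_coef_gt0 j : 0 < W_coef n tau j.
Proof.
rewrite /W_coef ltr_wpDl ?last_weight_gt0// sumr_ge0// => i _.
by rewrite mulr_ge0 ?gamma_ge0 ?inv_prev2_ge0.
Qed.

(** The diagonal term equals [a j / (th0 * vth j.-1)]. Splitting it isolates the coefficient of the
    gap in [Delta] and leaves the weights whose sum is [W_coef]. *)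
Lemma sum_gamma_inv_prev2 (a : nat -> R) j : (0 < j)%N ->
  \sum_(i < j.+1) g j i * inv_prev2 n tau i * a i =
  \sum_(i < j) g j i * inv_prev2 n tau i * a i + last_weight n tau j * a j +
  (1 - th0) / th0 ^+ 2 * a j.
Proof.
case: j => // j _; rewrite big_ord_recr /= gamma_diag -addrA.
congr (_ + _); rewrite -mulrDl; congr (_ * _).
rewrite /last_weight -[j.+1.-1]/j -[vth 0]/th0 theta0V.
have := vartheta_gt0 j; move: (vth j) => t t0.
by field; rewrite !gt_eqF.
Qed.

End coefficients.

(** * Timing of the restarts *)

Section restarts.
Context {R : realType} (n : nat) (tau : R) (K : nat).

Local Notation lr := (last_restart K).

Lemma last_restart_le k : (lr k <= k)%N.
Proof. by elim: k => //= k ih; case: ifP => // _; exact: leqW. Qed.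

Lemma last_restart_const k m : (lr k <= m <= k)%N -> lr m = lr k.
Proof.
elim: k => [|k ih]; first by rewrite leqn0 => /andP[_ /eqP ->].
case/andP => h1; rewrite leq_eqVlt => /orP[/eqP -> //|]; rewrite ltnS => h2.
move: h1; rewrite [lr k.+1]/=; case: ifP => _ h1; last by apply: ih; rewrite h1.
by move: (leq_trans h1 h2); rewrite ltnn.
Qed.

Lemma last_restart_ndvd k m : (lr k <= m < k)%N -> (K %| m)%N = false.
Proof.
case/andP => h1 h2; apply/negP => Km.
have := @last_restart_const k m.+1; rewrite (leqW h1) h2 /= Km => /(_ isT) h.
by move: h1; rewrite -h ltnn.
Qed.

Lemma theta_vartheta k : theta n tau K k = vartheta n tau (k - lr k).
Proof.
elim: k => //= k ih; case: ifP => _; first by rewrite subnn.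
by rewrite subSn ?last_restart_le// ih.
Qed.

(** Replacement follows the iterations whose number is a multiple of [K]: the first epoch is
    iteration 0 alone, and the later ones start at [m * K + 1]. *)
Lemma last_restartE m r : (r < K)%N -> lr (m * K + r.+1) = (m * K).+1.
Proof.
elim: r => [|r ih] rK; first by rewrite addn1 /= dvdn_mull.
rewrite addnS /= ih ?(ltnW rK)// dvdn_addr ?dvdn_mull//.
by rewrite gtnNdvd.
Qed.

End restarts.

(** * Convexity *)

Section convexity.
Context {R : realType}.

(** The predicate [C] is a convex domain outside which [phi] carries no information. Membership is
    proved along with the inequality, since the induction step applies [conv] to the partial
    combination. *)
Lemma jensen (V : lmodType R) (C : V -> Prop) (phi : V -> R) :
  (forall x y t, C x -> C y -> 0 <= t <= 1 ->
     C (t *: x + (1 - t) *: y) /\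
     phi (t *: x + (1 - t) *: y) <= t * phi x + (1 - t) * phi y) ->
  forall m (c : nat -> R) (a : nat -> V),
  (forall i, (i < m)%N -> 0 <= c i) -> \sum_(i < m) c i = 1 ->
  (forall i, (i < m)%N -> C (a i)) ->
  C (\sum_(i < m) c i *: a i) /\
  phi (\sum_(i < m) c i *: a i) <= \sum_(i < m) c i * phi (a i).
Proof.
move=> conv; elim=> [|m ih] c a c0.
  by rewrite big_ord0 => /eqP; rewrite eq_sym oner_eq0.
rewrite !big_ord_recr /= => sc Ca.
have s0 : 0 <= \sum_(i < m) c i by apply: sumr_ge0 => i _; exact/c0/leqW.
have cm0 : 0 <= c m by rewrite c0.
(* The induction hypothesis is used with the first [m] weights rescaled by their sum; if that sum is
   0, only the last point counts. *)
have [s00|sn0] := eqVneq (\sum_(i < m) c i) 0.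
  have cm1 : c m = 1 by rewrite -sc s00 add0r.
  have ci0 (i : 'I_m) : c i = 0.
    by apply: (psumr_eq0P _ s00) => // l _; exact/c0/leqW.
  have -> : \sum_(i < m) c i *: a i = 0.
    by apply: big1 => i _; rewrite ci0 scale0r.
  have -> : \sum_(i < m) c i * phi (a i) = 0.
    by apply: big1 => i _; rewrite ci0 mul0r.
  by rewrite cm1 !add0r scale1r mul1r; split => //; apply: Ca.
set s := \sum_(i < m) c i in s0 sc sn0 *.
have [Cs ps] : C (\sum_(i < m) (c i / s) *: a i) /\
    phi (\sum_(i < m) (c i / s) *: a i) <= \sum_(i < m) c i / s * phi (a i).
  apply: (ih (fun i => c i / s)) => [i im||i im].
  - by rewrite divr_ge0//; exact/c0/leqW.
  - by rewrite -mulr_suml divff.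
  - exact/Ca/leqW.
have -> : c m = 1 - s by rewrite -sc [s + _]addrC addrK.
have -> : \sum_(i < m) c i *: a i = s *: \sum_(i < m) (c i / s) *: a i.
  by rewrite scaler_sumr; apply: eq_bigr => i _; rewrite scalerA mulrC divfK.
have -> : \sum_(i < m) c i * phi (a i) = s * \sum_(i < m) c i / s * phi (a i).
  by rewrite mulr_sumr; apply: eq_bigr => i _; rewrite mulrA [s * _]mulrC divfK.
have [|h1 h2] := conv _ (a m) s Cs (Ca _ (ltnSn m)).
  by rewrite s0 -sc lerDl.
by split => //; apply: le_trans h2 _; rewrite lerD2r ler_wpM2l.
Qed.

Lemma convex_functionP (V : lmodType R) (f : V -> R) :
  @convex_function R V [set: V] f ->
  forall x y t, 0 <= t <= 1 ->
  f (t *: x + (1 - t) *: y) <= t * f x + (1 - t) * f y.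
Proof.
move=> cf x y t t01.
by have := cf (Itv01 (andP t01).1 (andP t01).2) x y; rewrite !in_setT; exact.
Qed.

Lemma closed_convexP (g : R -> \bar R) : closed_convex g ->
  forall x y (a b t : R), (g x <= a%:E)%E -> (g y <= b%:E)%E -> 0 <= t <= 1 ->
  (g (t * x + (1 - t) * y)%R <= (t * a + (1 - t) * b)%:E)%E.
Proof.
move=> [_ cg] x y a b t ga gb t01.
have := cg (x, a) (y, b) (Itv01 (andP t01).1 (andP t01).2).
by rewrite !in_setE /epigraph /=; apply.
Qed.

Lemma fin_num_le_pinfty (e : \bar R) (r : R) :
  e != -oo%E -> (e <= r%:E)%E -> e \is a fin_num.
Proof.
by move=> eN er; rewrite fin_numE eN/=; apply/eqP => e0; move: er; rewrite e0.
Qed.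

Lemma fine_convex (g : R -> \bar R) : (forall u, g u != -oo%E) ->
  closed_convex g -> forall x y t,
  g x \is a fin_num -> g y \is a fin_num -> 0 <= t <= 1 ->
  g (t * x + (1 - t) * y) \is a fin_num /\
  fine (g (t * x + (1 - t) * y)) <= t * fine (g x) + (1 - t) * fine (g y).
Proof.
move=> gN cg x y t gx gy t01.
have h : (g (t * x + (1 - t) * y)%R <=
          (t * fine (g x) + (1 - t) * fine (g y))%:E)%E.
  by apply: closed_convexP => //; rewrite fineK.
have fg := fin_num_le_pinfty (gN _) h.
by split => //; rewrite -lee_fin fineK.
Qed.

(* Compares the minimiser with points of the segment towards [u] close to it. *)
Lemma argmin_quadratic_growth (phi : R -> R) (b u0 u : R) :
  (forall t, 0 <= t <= 1 ->
     phi u0 <= t * phi u + (1 - t) * phi u0 - b * (t * (1 - t)) * (u - u0) ^+ 2) ->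
  phi u0 + b * (u - u0) ^+ 2 <= phi u.
Proof.
move=> h; set q := b * (u - u0) ^+ 2.
have h' t : 0 < t <= 1 -> (1 - t) * q <= phi u - phi u0.
  case/andP => t0 t1; have := h t; rewrite (ltW t0) t1 => /(_ isT) ht.
  rewrite -(ler_pM2l t0) /q; lra.
case: (leP q (phi u - phi u0)) => [|qlt]; first lra.
have [q0|q0] := leP q 0.
  have := h' 1; rewrite ltr01 lexx => /(_ isT); lra.
(* This [t] makes [t * q] at most half the excess of [q] over [phi u - phi u0], so that [h'] at [t]
   contradicts [qlt]. *)
pose t := Num.min 1 ((q - (phi u - phi u0)) / (2 * q)).
have t0 : 0 < t.
  by rewrite lt_min ltr01 /=; apply: divr_gt0; [rewrite subr_gt0 | apply: mulr_gt0].
have t1 : t <= 1 by rewrite ge_min lexx.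
have tq : t * q <= (q - (phi u - phi u0)) / 2.
  apply: le_trans (_ : (q - (phi u - phi u0)) / (2 * q) * q <= _).
    by rewrite ler_wpM2r ?(ltW q0)// ge_min lexx orbT.
  by rewrite invfM -mulrA -[_ * q]mulrA mulVf ?mulr1 ?gt_eqF.
have := h' t; rewrite t0 t1 => /(_ isT); lra.
Qed.

(** The quadratic part satisfies the hypothesis of [argmin_quadratic_growth] with equality, and
    convexity of [g] supplies the rest. Comparison with the finite value at [u] makes the value at
    the minimiser finite. *)
Lemma argmin_three_point (g : R -> \bar R) (a b y z u0 u : R) :
  0 <= b -> (forall w, g w != -oo%E) -> closed_convex g ->
  g u \is a fin_num ->
  is_argmin (fun w => (a * (w - y) + b * `|w - z| ^+ 2)%:E + g w)%E u0 ->
  g u0 \is a fin_num /\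
  a * (u0 - y) + b * (u0 - z) ^+ 2 + fine (g u0) + b * (u - u0) ^+ 2 <=
  a * (u - y) + b * (u - z) ^+ 2 + fine (g u).
Proof.
move=> b0 gN cg gu am.
have gu0 : g u0 \is a fin_num.
  have := am u; rewrite -(fineK gu) => le.
  rewrite fin_numE gN /=; apply/eqP => e0; move: le.
  by rewrite e0 addeC.
split => //.
apply: (@argmin_quadratic_growth
  (fun w => a * (w - y) + b * (w - z) ^+ 2 + fine (g w))) => t t01 /=.
have [gt ft] := fine_convex gN cg gu gu0 t01.
have := am (t * u + (1 - t) * u0).
rewrite -(fineK gt) -(fineK gu0) -!EFinD lee_fin !real_normK ?num_real// => le.
apply: le_trans le _; rewrite -subr_ge0; move: ft; rewrite -subr_ge0.
set e := (X in 0 <= X) => e0; set e' := (X in _ <= X).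
suff -> : e' = e by [].
by rewrite /e /e'; ring.
Qed.

(** Each minimiser is compared with the other by the three-point inequality, and the sum forces
    their distance to vanish. The finite point [w] excludes a [g] identically [+oo], for which every
    point is a minimiser. *)
Lemma argmin_unique (g : R -> \bar R) (a b y z u u' : R) :
  0 < b -> (forall w, g w != -oo%E) -> closed_convex g ->
  (exists w, g w \is a fin_num) ->
  is_argmin (fun w => (a * (w - y) + b * `|w - z| ^+ 2)%:E + g w)%E u ->
  is_argmin (fun w => (a * (w - y) + b * `|w - z| ^+ 2)%:E + g w)%E u' ->
  u = u'.
Proof.
move=> b0 gN cg [w gw] am am'.
have [gu _] := argmin_three_point (ltW b0) gN cg gw am.
have [gu' h] := argmin_three_point (ltW b0) gN cg gu am'.
have [_ h'] := argmin_three_point (ltW b0) gN cg gu' am.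
have : b * (u - u') ^+ 2 <= 0 by have := mulr_ge0 (ltW b0) (sqr_ge0 (u' - u)); lra.
by rewrite pmulr_rle0// real_exprn_even_le0 ?num_real//= subr_eq0 => /eqP.
Qed.

(** Difference quotients along the segment from [y] to [x] are at most [f x - f y], and the
    directional derivative is their limit from the right. *)
Lemma convex_gradient_le n (f : 'rV[R]_n -> R) (x y : 'rV[R]_n) :
  @convex_function R 'rV[R]_n [set: 'rV[R]_n] f -> differentiable f y ->
  f y + \sum_(i < n) partial_derivative f i y * (x - y) ord0 i <= f x.
Proof.
move=> cf df.
have -> : \sum_(i < n) partial_derivative f i y * (x - y) ord0 i = 'D_(x - y) f y.
  rewrite deriveE// [in RHS](row_sum_delta (x - y)) linear_sum.
  apply: eq_bigr => i _; rewrite linearZ /= /partial_derivative deriveE//.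
  by rewrite mulrC.
rewrite -lerBrDl.
have dv : derivable f y (x - y) by exact: diff_derivable.
apply: (@cvgr_to_le _ 0^'+ _ _ (fun h : R => h^-1 *: ((f \o shift y) (h *: (x - y)) - f y))).
  exact: cvg_dnbhs_at_right.
near=> t.
have t0 : 0 < t by near: t; exact: nbhs_right_gt.
have t1 : t <= 1 by near: t; exact: nbhs_right_le.
rewrite /GRing.scale /= mulrC ler_pdivrMr// lerBlDl.
have -> : t *: (x - y) + y = t *: x + (1 - t) *: y.
  by rewrite scalerBr scalerBl scale1r addrAC addrA.
apply: le_trans (convex_functionP cf x y _) _; first by rewrite (ltW t0).
lra.
Unshelve. all: by end_near.
Qed.

End convexity.

(** * Expectations over the draws *)

Section finite_expectation.
Context {R : realType}.
Local Open Scope ereal_scope.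

(** The integrand is a finite combination of indicators of the fibres of [X], hence the hypothesis
    on fibres. *)
Lemma integral_fintype d (T : measurableType d) (P : probability T R)
    (U : finType) (X : T -> U) (g : U -> R) :
  (forall u, measurable (X @^-1` [set u])) ->
  \int[P]_w (g (X w))%:E =
  (\sum_u g u * fine (P (X @^-1` [set u])))%R%:E.
Proof.
move=> mX; pose h u w := ((g u)%:E * (\1_(X @^-1` [set u]) w)%:E).
have hE w : (g (X w))%:E = \sum_u h u w.
  rewrite (bigD1 (X w))//= /h indicE mem_set//= mule1 big1 ?adde0// => u uX.
  by rewrite indicE memNset ?mule0// => /= XE; rewrite XE eqxx in uX.
have ih u : P.-integrable [set: T] (h u).
  by apply: integrableZl => //; exact: integrable_indic.
under eq_integral do rewrite hE.
rewrite integral_sum// -sumEFin; apply: eq_bigr => u _.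
rewrite /h integralZl//; last exact: integrable_indic.
by rewrite integral_indic// setIT EFinM fineK// fin_num_measure.
Qed.

End finite_expectation.

(** * Law of the first draws *)

Section histories.
Context {R : realType} {d} {T : measurableType d} (P : probability T R).
Context {I : finType} (S : nat -> {RV P >-> {set I}}) (q : {set I} -> R).
Hypothesis S_indep : mutually_independent S.
Hypothesis S_law : forall k A, P (S k @^-1` [set A]) = (q A)%:E.

Let hist k w := mkseq (fun i => S i w) k.

Lemma measurable_draw k (B : set {set I}) : measurable (S k @^-1` B).
Proof. by rewrite -[X in measurable X]setTI; exact: measurable_funP. Qed.

Let mem_initial m j : (j \in [fset i in iota 0 m]%fset) = (j < m)%N.
Proof. by rewrite in_fset /= mem_iota. Qed.

(** As an intersection over an initial segment of indices, the event falls under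
    [mutually_independent]. With [A] as the default of [nth], the same sets serve for [m = size t]
    and for [m = size t + 1]. *)
Lemma histE (A : {set I}) (t : seq {set I}) (m : nat) :
  (m <= (size t).+1)%N ->
  [set w | hist m w = take m (rcons t A)] =
  \bigcap_(j in [set` [fset i in iota 0 m]%fset]) (S j @^-1` [set nth A t j]).
Proof.
move=> mt; have nthA j : nth A (rcons t A) j = nth A t j.
  rewrite nth_rcons; case: ltngtP => // h; last by rewrite h nth_default.
  by rewrite nth_default// ltnW.
apply/seteqP; split => w /=.
  move=> hw j; rewrite /= mem_initial => jm.
  by rewrite -nthA -(nth_take A jm) -hw nth_mkseq.
move=> hw; apply: (@eq_from_nth _ A).
  by rewrite size_mkseq size_takel// size_rcons.
move=> j; rewrite size_mkseq => jm; rewrite nth_mkseq// nth_take// nthA.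
by apply: hw; rewrite /= mem_initial.
Qed.

Lemma measurable_hist t : measurable [set w | hist (size t) w = t].
Proof.
case: (lastP t) => [|t' A]; first by rewrite (_ : [set w | _] = setT)// predeqE.
have -> : [set w | hist (size (rcons t' A)) w = rcons t' A] =
          [set w | hist (size t').+1 w = take (size t').+1 (rcons t' A)].
  by rewrite size_rcons take_oversize// size_rcons.
rewrite histE//; apply: fin_bigcap_measurable => // j _.
exact: measurable_draw.
Qed.

Lemma prob_hist_rcons t A :
  P [set w | hist (size t).+1 w = rcons t A] =
  (P [set w | hist (size t) w = t] * (q A)%:E)%E.
Proof.
have -> : [set w | hist (size t).+1 w = rcons t A] =
          [set w | hist (size t).+1 w = take (size t).+1 (rcons t A)].
  by rewrite take_oversize// size_rcons.
have -> : [set w | hist (size t) w = t] =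
          [set w | hist (size t) w = take (size t) (rcons t A)].
  by rewrite -cats1 take_size_cat.
rewrite !histE// !S_indep//.
have -> : [fset i in iota 0 (size t).+1]%fset =
          (size t |` [fset i in iota 0 (size t)])%fset.
  by apply/fsetP => i; rewrite in_fset1U !mem_initial ltnS leq_eqVlt.
rewrite big_fsetU1/=; last by rewrite mem_initial ltnn.
by rewrite nth_default// S_law muleC.
Qed.

(** The last draw is averaged out first, so the passage from [k.+1] to [k] is a conditional
    expectation given the first [k] draws. *)
Fixpoint history_mean k (g : seq {set I} -> R) : R :=
  if k is k'.+1 then
    history_mean k' (fun t => \sum_A q A * g (rcons t A))
  else g [::].

(** By [prob_hist_rcons] the joint law of a history and the next draw is a product, and both range
    over finite types once histories of length [k] are tuples. *)
Lemma integral_history k (g : seq {set I} -> R) :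
  (\int[P]_w (g (hist k w))%:E = (history_mean k g)%:E)%E.
Proof.
elim: k g => [|k ih] g.
  rewrite -[LHS]/(\int[P]_w (cst (g [::])%:E w))%E.
  by rewrite integral_cst//= probability_setT mule1.
rewrite /= -ih.
have sz w : size (hist k w) == k by rewrite size_mkseq.
pose X w := (Tuple (sz w), S k w).
have XE t : X @^-1` [set t] =
    [set w | hist (size t.1).+1 w = rcons t.1 t.2].
  case: t => [t A]; rewrite size_tuple; apply/seteqP; split => w /=.
    by rewrite /X => -[<- <-]; rewrite /hist mkseqS.
  rewrite /hist mkseqS => /rcons_inj[ht hA].
  by congr pair => //; exact: val_inj.
have XE' t : (fun w => Tuple (sz w)) @^-1` [set t] =
    [set w | hist (size t) w = t].
  apply/seteqP; split => w /=; rewrite size_tuple; first by move=> <-.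
  by move=> h; exact: val_inj.
have mX u : measurable (X @^-1` [set u]).
  by rewrite XE -(size_rcons _ u.2); exact: measurable_hist.
have mX' u : measurable ((fun w => Tuple (sz w)) @^-1` [set u]).
  by rewrite XE'; exact: measurable_hist.
have := integral_fintype P (fun p : k.-tuple _ * _ => g (rcons p.1 p.2)) mX.
have := integral_fintype P (fun t : k.-tuple _ => \sum_A q A * g (rcons t A)) mX'.
move=> /= ->; under eq_integral => w _ do rewrite -mkseqS.
move=> ->.
pose F (t : k.-tuple {set I}) (A : {set I}) :=
  g (rcons t A) * fine (P (X @^-1` [set (t, A)])).
congr (_%:E); rewrite (eq_bigr (fun u => F u.1 u.2)); last by case.
rewrite -(pair_bigA _ F).
apply: eq_bigr => t _; rewrite mulr_suml; apply: eq_bigr => A _.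
rewrite /F XE XE' prob_hist_rcons fineM ?fin_num_measure//; last exact: measurable_hist.
by rewrite /=; ring.
Qed.

(** By independence the probability of the history is a product of positive factors, so the event is
    not empty. *)
Lemma history_realised t : all (fun A => 0 < q A) t ->
  exists w, hist (size t) w = t.
Proof.
move=> qt; suff : (0 < P [set w | hist (size t) w = t])%E.
  move=> P0; have [[w hw]|/nonemptyPn h0] :=
    pselect ([set w | hist (size t) w = t] !=set0); first by exists w.
  by move: P0; rewrite h0 measure0 ltxx.
elim/last_ind: t qt => [_|t A ih].
  by rewrite (_ : [set w | _] = setT) ?probability_setT// predeqE.
by rewrite all_rcons size_rcons prob_hist_rcons => /andP[qA /ih h]; rewrite mule_gt0.
Qed.

End histories.

(** * Means of quantities determined by the draws *)

Section mean.
Context {R : realType} {I : finType} (q : {set I} -> R).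
Hypothesis q_ge0 : forall A, 0 <= q A.
Hypothesis q_sum1 : \sum_A q A = 1.

Lemma history_mean_le k (g g' : seq {set I} -> R) :
  (forall t, size t = k -> all (fun A => 0 < q A) t -> g t <= g' t) ->
  history_mean q k g <= history_mean q k g'.
Proof.
elim: k g g' => [|k ih] g g' gg'; first exact: gg'.
apply: ih => t tk qt; apply: ler_sum => A _.
have [qA|] := ltP 0 (q A).
  by rewrite ler_wpM2l// gg' ?size_rcons ?tk// all_rcons qA.
move=> qA; have -> : q A = 0 by apply/eqP; rewrite eq_le qA q_ge0.
by rewrite !mul0r.
Qed.

Lemma history_mean_linear k (a b : R) (g g' : seq {set I} -> R) :
  history_mean q k (fun t => a * g t + b * g' t) =
  a * history_mean q k g + b * history_mean q k g'.
Proof.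
elim: k g g' => //= k ih g g'; rewrite -ih; congr (history_mean q k _).
apply/funext => t; rewrite !mulr_sumr -big_split; apply: eq_bigr => A _ /=.
by rewrite mulrDr; congr (_ + _); rewrite mulrCA.
Qed.

Context {T : Type} (S : nat -> T -> {set I}).
Context (wit : seq {set I} -> T).

Definition history k w := mkseq (fun i => S i w) k.

Definition likely k w := all (fun A => 0 < q A) (history k w).

Definition adapted {U : Type} k (G : T -> U) :=
  forall w w', history k w = history k w' -> G w = G w'.

(** For a likely history [t], [wit t] is an outcome realising it. On quantities that depend on the
    first [k] draws only, this is the expectation. *)
Definition mean k (G : T -> R) := history_mean q k (G \o wit).

Lemma history_le i k w w' : (i <= k)%N ->
  history k w = history k w' -> history i w = history i w'.
Proof.
by move=> ik /(congr1 (take i)); rewrite /history -!map_take take_iota (minn_idPl ik).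
Qed.

Hypothesis witP : forall t, all (fun A => 0 < q A) t ->
  history (size t) (wit t) = t.

Lemma mean_le k G G' : (forall w, likely k w -> G w <= G' w) ->
  mean k G <= mean k G'.
Proof.
move=> GG'; apply: history_mean_le => t tk qt; apply: GG'.
by rewrite /likely -tk witP.
Qed.

Lemma mean_linear k a b G G' :
  mean k (fun w => a * G w + b * G' w) = a * mean k G + b * mean k G'.
Proof. exact: history_mean_linear. Qed.

Lemma mean_sum k m (c : nat -> R) (G : nat -> T -> R) :
  mean k (fun w => \sum_(i < m) c i * G i w) = \sum_(i < m) c i * mean k (G i).
Proof.
elim: m => [|m ih].
  rewrite big_ord0 -(mul0r (mean k (fun=> 0))) -[RHS]addr0.
  rewrite -(mul0r (mean k (fun=> 0))) -mean_linear.
  by congr (mean k _); apply/funext => w; rewrite big_ord0 !mul0r addr0.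
rewrite big_ord_recr /= -ih -[X in X + _]mul1r -mean_linear.
by congr (mean k _); apply/funext => w; rewrite big_ord_recr mul1r.
Qed.

(** The hypothesis is a one-step supermartingale inequality: [e A] prolongs the history of [w] by
    the draw [A], and is arbitrary when [A] has weight 0. *)
Lemma mean_step k G G' :
  (forall w (e : {set I} -> T), likely k w ->
    (forall A, 0 < q A -> history k.+1 (e A) = rcons (history k w) A) ->
    \sum_A q A * G' (e A) <= G w) ->
  mean k.+1 G' <= mean k G.
Proof.
move=> h; rewrite /mean /=; apply: history_mean_le => t tk qt /=.
apply: (h _ (fun A => wit (rcons t A))) => [|A qA].
  by rewrite /likely -tk witP.
by rewrite -{1 2}tk witP// -(size_rcons t A) witP// all_rcons qA.
Qed.

(** Draws after time [i] average out because the weights sum to 1. Both inequalities are instances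
    of [mean_step], the second one for [- G]. *)
Lemma mean_adapted i k G : (i <= k)%N -> adapted i G -> mean k G = mean i G.
Proof.
move=> ik adG; rewrite -(subnKC ik); elim: (k - i)%N => [|m ih].
  by rewrite addn0.
rewrite addnS -ih; apply/le_anti/andP.
have eG w (e : {set I} -> T) A :
    history (i + m).+1 (e A) = rcons (history (i + m) w) A -> G (e A) = G w.
  rewrite /history mkseqS => /rcons_inj[he _].
  by apply: adG; apply: history_le he; exact: leq_addr.
have eG' w (e : {set I} -> T) :
    (forall A, 0 < q A ->
       history (i + m).+1 (e A) = rcons (history (i + m) w) A) ->
    \sum_A q A * G (e A) = G w.
  move=> he; rewrite -[RHS]mul1r -q_sum1 mulr_suml; apply: eq_bigr => A _.
  have [qA|qA] := ltP 0 (q A); first by rewrite (eG _ _ _ (he _ qA)).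
  have -> : q A = 0 by apply/eqP; rewrite eq_le qA q_ge0.
  by rewrite !mul0r.
split; first by apply: mean_step => w e _ /eG' ->.
rewrite -lerN2.
have mN j H : - mean j H = mean j (fun w => - H w).
  rewrite -[LHS]addr0 -mulN1r -(mul0r (mean j H)) -mean_linear.
  by congr (mean j _); apply/funext => w; rewrite mulN1r mul0r addr0.
rewrite !mN; apply: mean_step => w e _ /eG' <-.
by rewrite -sumrN; apply: ler_sum => A _; rewrite mulrN.
Qed.

End mean.

(** * One coordinate step *)

Section descent.
Context {R : realType} {n : nat} (tau : R).
Context (f : 'rV[R]_n -> R) (psi : 'I_n -> R -> \bar R) (v : 'rV[R]_n).
Context (q : {set 'I_n} -> R).

Local Notation th0 := (theta0 n tau).

Definition proper_point (x : 'rV[R]_n) := forall i, psi i (x ord0 i) \is a fin_num.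

(* [fine] sends [+oo] to [0]: meaningful at proper points only. *)
Definition fpsi (x : 'rV[R]_n) : R := \sum_(i < n) fine (psi i (x ord0 i)).

Definition fobj (x : 'rV[R]_n) : R := f x + fpsi x.

Definition partial_update (A : {set 'I_n}) (u z : 'rV[R]_n) : 'rV[R]_n :=
  \row_i (if i \in A then u ord0 i else z ord0 i).

(** This is [coord_model] with the step size as an argument, so that an epoch can be indexed from
    its own start. *)
Definition update_model t i (y z : 'rV[R]_n) (w : R) : \bar R :=
  ((partial_derivative f i y * (w - y ord0 i) +
    t * n%:R * v ord0 i / (2 * tau) * `|w - z ord0 i| ^+ 2)%:E + psi i w)%E.

Hypothesis f_convex : @convex_function R 'rV[R]_n [set: 'rV[R]_n] f.
Hypothesis f_diff : forall x, differentiable f x.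
Hypothesis psi_ninfty : forall i u, psi i u != -oo%E.
Hypothesis psi_cc : forall i, closed_convex (psi i).
Hypothesis v_gt0 : forall i, 0 < v ord0 i.
Hypothesis tau_gt0 : 0 < tau.
Hypothesis n_gt0 : (0 < n)%N.
Hypothesis q_sum1 : \sum_A q A = 1.
Hypothesis q_marginal : forall i, \sum_A q A * (i \in A)%:R = th0.
Hypothesis q_eso : forall x h,
  \sum_A q A * f (x + coord_restrict A h) <=
  f x + th0 * (\sum_(i < n) partial_derivative f i x * h ord0 i + 2^-1 * wnorm2 v h).

Lemma theta0_gt0 : 0 < th0.
Proof. by rewrite /theta0 divr_gt0// ltr0n. Qed.

(** Coordinate [i] is replaced with probability [th0], and a separable function sees only these
    marginals. *)
Lemma mean_partial_update (phi : 'I_n -> R -> R) (u z : 'rV[R]_n) :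
  \sum_A q A * (\sum_(i < n) phi i (partial_update A u z ord0 i)) =
  (1 - th0) * (\sum_(i < n) phi i (z ord0 i)) +
  th0 * (\sum_(i < n) phi i (u ord0 i)).
Proof.
under eq_bigr do rewrite mulr_sumr.
rewrite exchange_big /= !mulr_sumr -big_split; apply: eq_bigr => i _ /=.
have -> : 1 - th0 = \sum_A q A * (1 - (i \in A)%:R).
  rewrite -(q_marginal i) -{1}q_sum1 -sumrB.
  by apply: eq_bigr => A _; rewrite mulrBr mulr1.
rewrite -(q_marginal i) !mulr_suml -big_split.
by apply: eq_bigr => A _; rewrite mxE /=; case: (i \in A); rewrite /=; ring.
Qed.

Lemma wnorm2C (x y : 'rV[R]_n) : wnorm2 v (x - y) = wnorm2 v (y - x).
Proof. by apply: eq_bigr => i _; rewrite !mxE -sqrrN opprB. Qed.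

Lemma wnorm2Z (a : R) (x : 'rV[R]_n) : wnorm2 v (a *: x) = a ^+ 2 * wnorm2 v x.
Proof. by rewrite mulr_sumr; apply: eq_bigr => i _; rewrite !mxE exprMn mulrCA. Qed.

Lemma wnorm2_ge0 (x : 'rV[R]_n) : 0 <= wnorm2 v x.
Proof. by apply: sumr_ge0 => i _; rewrite mulr_ge0 ?sqr_ge0// ltW. Qed.

Lemma update_model_three_point t (y z u w : 'rV[R]_n) : 0 < t ->
  proper_point w -> (forall i, is_argmin (update_model t i y z) (u ord0 i)) ->
  \sum_(i < n) partial_derivative f i y * (u - y) ord0 i +
    t / (2 * th0) * wnorm2 v (u - z) + fpsi u + t / (2 * th0) * wnorm2 v (w - u)
  <= \sum_(i < n) partial_derivative f i y * (w - y) ord0 i +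
    t / (2 * th0) * wnorm2 v (w - z) + fpsi w.
Proof.
move=> t0 pw am; rewrite !mulr_sumr -!big_split; apply: ler_sum => i _ /=.
have b0 : 0 <= t * n%:R * v ord0 i / (2 * tau).
  by rewrite divr_ge0 ?mulr_ge0 ?ler0n// ltW.
have [_] := argmin_three_point b0 (psi_ninfty i) (psi_cc i) (pw i) (am i).
have -> : t * n%:R * v ord0 i / (2 * tau) = t / (2 * th0) * v ord0 i.
  by rewrite /theta0; field; rewrite !gt_eqF// ltr0n.
by rewrite !mxE !mulrA.
Qed.

(** Every draw takes its sampled coordinates from one full minimiser [u]; [p] stands in for the
    psi-value at [x]. The ESO bounds the mean of [f]; convexity at [x] and [xs], with weights
    [1 - t] and [t], and the three-point inequality at [xs] do the rest. *)
Lemma approx_step_descent (x z u xs : 'rV[R]_n) (t p : R) :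
  let y := (1 - t) *: x + t *: z in
  let znew A := partial_update A u z in
  0 < t <= 1 -> proper_point xs ->
  (forall i, is_argmin (update_model t i y z) (u ord0 i)) ->
  \sum_A q A *
    ((f (y + (n%:R / tau * t) *: (znew A - z)) +
      ((1 - t) * p + n%:R / tau * t * fpsi (znew A) +
       (t - n%:R / tau * t) * fpsi z) - fobj xs) / t ^+ 2 +
     (2 * th0 ^+ 2)^-1 * wnorm2 v (znew A - xs)) <=
  (1 - t) / t ^+ 2 * (f x + p - fobj xs) + (2 * th0 ^+ 2)^-1 * wnorm2 v (z - xs).
Proof.
move=> y znew /andP[t0 t1] pxs am; have h0 := theta0_gt0.
rewrite theta0V; set a := th0^-1 * t.
pose Ef := \sum_A q A * f (y + a *: (znew A - z)).
have -> : \sum_A q A *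
    ((f (y + a *: (znew A - z)) +
      ((1 - t) * p + a * fpsi (znew A) + (t - a) * fpsi z) - fobj xs) / t ^+ 2 +
     (2 * th0 ^+ 2)^-1 * wnorm2 v (znew A - xs)) =
   (Ef + (1 - t) * p + t * fpsi u - fobj xs) / t ^+ 2 +
   (2 * th0 ^+ 2)^-1 * ((1 - th0) * wnorm2 v (z - xs) + th0 * wnorm2 v (u - xs)).
  have mpsi := mean_partial_update (fun i w => fine (psi i w)) u z.
  have mnorm := mean_partial_update (fun i w => v ord0 i * (w - xs ord0 i) ^+ 2) u z.
  have wn w : wnorm2 v (w - xs) = \sum_(i < n) v ord0 i * (w ord0 i - xs ord0 i) ^+ 2.
    by apply: eq_bigr => i _; rewrite !mxE.
  rewrite !wn -mnorm.
  (* Since [a * th0 = t], the terms in [fpsi z] cancel on averaging; this is the purpose of the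
     factor [t - a]. *)
  have -> : t * fpsi u = a * (\sum_A q A * fpsi (znew A)) + (t - a) * fpsi z.
    rewrite mpsi -/(fpsi z) -/(fpsi u) /a; field; exact: lt0r_neq0.
  pose C := ((1 - t) * p + (t - a) * fpsi z - fobj xs) / t ^+ 2.
  rewrite (eq_bigr (fun A => q A * f (y + a *: (znew A - z)) / t ^+ 2 + q A * C +
    q A * fpsi (znew A) * (a / t ^+ 2) +
    q A * (\sum_(i < n) v ord0 i * (znew A ord0 i - xs ord0 i) ^+ 2) *
      (2 * th0 ^+ 2)^-1)); last by move=> A _; rewrite wn /C; ring.
  by rewrite !big_split /= -!mulr_suml q_sum1 -/Ef /C; ring.
have Ef_le : Ef <= f y + t * (\sum_(i < n) partial_derivative f i y * (u - z) ord0 i) +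
    t ^+ 2 / (2 * th0) * wnorm2 v (u - z).
  (* The restriction of [a *: (u - z)] to [A] is [a *: (znew A - z)]. *)
  have := q_eso y (a *: (u - z)).
  have -> : \sum_A q A * f (y + coord_restrict A (a *: (u - z))) = Ef.
    apply: eq_bigr => A _; congr (_ * f (_ + _)); apply/rowP => i; rewrite !mxE.
    by case: ifP => _; rewrite ?subrr ?mulr0.
  move=> /le_trans; apply; rewrite le_eqVlt; apply/orP; left; apply/eqP.
  rewrite wnorm2Z.
  have -> : \sum_(i < n) partial_derivative f i y * (a *: (u - z)) ord0 i =
            a * \sum_(i < n) partial_derivative f i y * (u - z) ord0 i.
    by rewrite mulr_sumr; apply: eq_bigr => i _; rewrite !mxE mulrCA.
  by rewrite /a; field; exact: lt0r_neq0.
have three := update_model_three_point t0 pxs am.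
have gx := convex_gradient_le x f_convex (f_diff y).
have gs := convex_gradient_le xs f_convex (f_diff y).
(* By the definition of [y], [t *: (y - z) = (1 - t) *: (x - y)]. *)
have Gz : \sum_(i < n) partial_derivative f i y * (u - z) ord0 i * t =
    t * (\sum_(i < n) partial_derivative f i y * (u - y) ord0 i) +
    (1 - t) * (\sum_(i < n) partial_derivative f i y * (x - y) ord0 i).
  rewrite !mulr_sumr -big_split; apply: eq_bigr => i _ /=; rewrite /y !mxE; ring.
rewrite -mulr_suml mulrC in Gz; rewrite Gz {Gz} in Ef_le.
move: three gx gs Ef_le; rewrite /fobj (wnorm2C xs u) (wnorm2C xs z).
move: (fpsi u) (fpsi xs) (f y) (f x) (f xs) (wnorm2 v (u - z)) (wnorm2 v (u - xs))
  (wnorm2 v (z - xs)) (\sum_(i < n) _ * (u - y) _ _) (\sum_(i < n) _ * (x - y) _ _)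
  (\sum_(i < n) _ * (xs - y) _ _) => pu ps fy fx fs N1 N2 N3 Gu Gx Gs three gx gs Ef_le.
have {}gx : (1 - t) * (fy + Gx) <= (1 - t) * fx by rewrite ler_wpM2l// subr_ge0.
have {}gs : t * (fy + Gs) <= t * fs by rewrite ler_wpM2l// ltW.
have {}three := ler_wpM2l (ltW t0) three.
rewrite -(ler_pM2l (exprn_gt0 2 t0)).
have -> : t ^+ 2 * ((Ef + (1 - t) * p + t * pu - (fs + ps)) / t ^+ 2 +
   (2 * th0 ^+ 2)^-1 * ((1 - th0) * N3 + th0 * N2)) =
   Ef + (1 - t) * p + t * pu - (fs + ps) +
   t ^+ 2 / (2 * th0) * (N2 - N3) + t ^+ 2 * ((2 * th0 ^+ 2)^-1 * N3).
  by field; rewrite !gt_eqF.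
have -> : t ^+ 2 * ((1 - t) / t ^+ 2 * (fx + p - (fs + ps)) +
   (2 * th0 ^+ 2)^-1 * N3) = (1 - t) * (fx + p - (fs + ps)) +
   t ^+ 2 * ((2 * th0 ^+ 2)^-1 * N3) by field; rewrite !gt_eqF.
rewrite lerD2r.
have -> : t ^+ 2 / (2 * th0) * (N2 - N3) =
  t * (t / (2 * th0) * N2) - t * (t / (2 * th0) * N3) by ring.
have e : t ^+ 2 / (2 * th0) * N1 = t * (t / (2 * th0) * N1) by ring.
rewrite e in Ef_le; move: three gx gs Ef_le.
move: (t / (2 * th0) * N1) (t / (2 * th0) * N2) (t / (2 * th0) * N3) => M1 M2 M3.
lra.
Qed.

End descent.

(** * The potential and strong convexity *)

Section potential.
Context {R : realType} {n : nat} (tau : R).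
Context (f : 'rV[R]_n -> R) (psi : 'I_n -> R -> \bar R) (v : 'rV[R]_n).
Context (xs : 'rV[R]_n) (mu : R).

Local Notation th0 := (theta0 n tau).
Local Notation proper := (proper_point psi).
Local Notation F := (fobj f psi).

(** The real value of [Delta] at proper points, see [Delta_potential]. *)
Definition potential (x : 'rV[R]_n) : R :=
  (1 - th0) / th0 ^+ 2 * (F x - F xs) + (2 * th0 ^+ 2)^-1 * wnorm2 v (x - xs).

Hypothesis f_convex : @convex_function R 'rV[R]_n [set: 'rV[R]_n] f.
Hypothesis psi_ninfty : forall i u, psi i u != -oo%E.
Hypothesis psi_cc : forall i, closed_convex (psi i).
Hypothesis v_gt0 : forall i, 0 < v ord0 i.
Hypothesis mu_gt0 : 0 < mu.
Hypothesis theta0_gt0 : 0 < th0.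
Hypothesis theta0_le1 : th0 <= 1.
Hypothesis xs_min : forall x, proper x -> F xs <= F x.
Hypothesis F_strong : forall x, proper x ->
  F xs + mu / 2 * wnorm2 v (x - xs) <= F x.

Lemma proper_point_convex x y t : proper x -> proper y -> 0 <= t <= 1 ->
  proper (t *: x + (1 - t) *: y).
Proof.
move=> px py t01 i; rewrite !mxE.
by have [] := fine_convex (psi_ninfty i) (psi_cc i) (px i) (py i) t01.
Qed.

Lemma fpsi_convex x y t : proper x -> proper y -> 0 <= t <= 1 ->
  fpsi psi (t *: x + (1 - t) *: y) <= t * fpsi psi x + (1 - t) * fpsi psi y.
Proof.
move=> px py t01; rewrite /fpsi !mulr_sumr -big_split; apply: ler_sum => i _ /=.
rewrite !mxE.
by have [] := fine_convex (psi_ninfty i) (psi_cc i) (px i) (py i) t01.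
Qed.

Lemma fobj_convex x y t : proper x -> proper y -> 0 <= t <= 1 ->
  F (t *: x + (1 - t) *: y) <= t * F x + (1 - t) * F y.
Proof.
move=> px py t01; rewrite /fobj.
have := fpsi_convex px py t01; have := convex_functionP f_convex x y t01; lra.
Qed.

Lemma dist_convex (x y : 'rV[R]_n) t : 0 <= t <= 1 ->
  wnorm2 v (t *: x + (1 - t) *: y - xs) <=
  t * wnorm2 v (x - xs) + (1 - t) * wnorm2 v (y - xs).
Proof.
case/andP => t0 t1; rewrite !mulr_sumr -big_split; apply: ler_sum => i _ /=.
rewrite !mxE -subr_ge0.
set e := (X in 0 <= X); suff -> : e = v ord0 i * (t * (1 - t)) *
    (x ord0 i - y ord0 i) ^+ 2.
  by rewrite mulr_ge0 ?sqr_ge0// mulr_ge0 ?(ltW (v_gt0 i))// mulr_ge0// subr_ge0.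
by rewrite /e; ring.
Qed.

Lemma potential_coef_ge0 : 0 <= (1 - th0) / th0 ^+ 2 /\ 0 <= (2 * th0 ^+ 2)^-1.
Proof.
have h2 : 0 <= th0 ^+ 2 by exact: sqr_ge0.
by rewrite divr_ge0 ?subr_ge0// invr_ge0 mulr_ge0.
Qed.

Lemma potential_convex x y t : proper x -> proper y -> 0 <= t <= 1 ->
  potential (t *: x + (1 - t) *: y) <= t * potential x + (1 - t) * potential y.
Proof.
move=> px py t01; have [c1 c2] := potential_coef_ge0; rewrite /potential.
have := ler_wpM2l c1 (fobj_convex px py t01).
have := ler_wpM2l c2 (dist_convex x y t01); lra.
Qed.

Lemma potential_ge0 x : proper x -> 0 <= potential x.
Proof.
move=> px; have [c1 c2] := potential_coef_ge0.
by rewrite addr_ge0// mulr_ge0// ?subr_ge0 ?xs_min// wnorm2_ge0.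
Qed.

Lemma m_coef_denom_gt0 : 0 < 1 + mu * (1 - th0).
Proof. by rewrite ltr_pwDl// mulr_ge0 ?subr_ge0// ltW. Qed.

Lemma m_coef_gt0 j : 0 < m_coef n tau j mu.
Proof.
apply: mulr_gt0; last exact: W_coef_gt0.
apply: divr_gt0; last exact: m_coef_denom_gt0.
by apply: mulr_gt0 => //; exact: exprn_gt0.
Qed.

(** Strong convexity bounds the distance term by the gap: [mu * th0 ^+ 2] times the potential is at
    most [1 + mu * (1 - th0)] times [F x - F xs]. This is the origin of the quotient in [m_coef]. *)
Lemma m_coef_potential j x : proper x ->
  m_coef n tau j mu * potential x <= W_coef n tau j * (F x - F xs).
Proof.
move=> px; rewrite /m_coef [_ * W_coef _ _ _]mulrC -[_ * _ * potential x]mulrA.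
rewrite ler_wpM2l ?(ltW (W_coef_gt0 theta0_gt0 theta0_le1 _))//.
rewrite mulrAC ler_pdivrMr ?m_coef_denom_gt0// /potential.
have -> : mu * th0 ^+ 2 * ((1 - th0) / th0 ^+ 2 * (F x - F xs) +
    (2 * th0 ^+ 2)^-1 * wnorm2 v (x - xs)) =
   mu * (1 - th0) * (F x - F xs) + mu / 2 * wnorm2 v (x - xs).
  by field; exact: lt0r_neq0.
have := F_strong px; lra.
Qed.

End potential.

(** * Epochs and restarts *)

Section algorithm.
Context {R : realType} {n : nat} (tau : R).
Context (f : 'rV[R]_n -> R) (psi : 'I_n -> R -> \bar R) (v : 'rV[R]_n).
Context (xs : 'rV[R]_n) (mu : R) (q : {set 'I_n} -> R).
Context {T : Type} (S : nat -> T -> {set 'I_n}) (wit : seq {set 'I_n} -> T).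

Local Notation th0 := (theta0 n tau).
Local Notation vth := (vartheta n tau).
Local Notation g := (gamma n tau).
Local Notation inv2 := (inv_prev2 n tau).
Local Notation proper := (proper_point psi).
Local Notation F := (fobj f psi).
Local Notation Psi := (fpsi psi).
Local Notation pot := (potential tau f psi v xs).
Local Notation EE := (mean q wit).

Hypothesis f_convex : @convex_function R 'rV[R]_n [set: 'rV[R]_n] f.
Hypothesis f_diff : forall x, differentiable f x.
Hypothesis psi_ninfty : forall i u, psi i u != -oo%E.
Hypothesis psi_cc : forall i, closed_convex (psi i).
Hypothesis v_gt0 : forall i, 0 < v ord0 i.
Hypothesis tau_gt0 : 0 < tau.
Hypothesis n_gt0 : (0 < n)%N.
Hypothesis theta0_le1 : th0 <= 1.
Hypothesis mu_gt0 : 0 < mu.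
Hypothesis xs_proper : proper xs.
Hypothesis xs_min : forall x, proper x -> F xs <= F x.
Hypothesis F_strong : forall x, proper x ->
  F xs + mu / 2 * wnorm2 v (x - xs) <= F x.
Hypothesis q_ge0 : forall A, 0 <= q A.
Hypothesis q_sum1 : \sum_A q A = 1.
Hypothesis q_marginal : forall i, \sum_A q A * (i \in A)%:R = th0.
Hypothesis q_eso : forall x h,
  \sum_A q A * f (x + coord_restrict A h) <=
  f x + th0 * (\sum_(i < n) partial_derivative f i x * h ord0 i + 2^-1 * wnorm2 v h).
Hypothesis witP : forall t, all (fun A => 0 < q A) t ->
  history S (size t) (wit t) = t.

Let th0_gt0 : 0 < th0 := theta0_gt0 tau_gt0 n_gt0.

(** A relation rather than a function, because minimisers are known to exist only where a run
    exhibits them. *)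
Definition approx_step t (A : {set 'I_n}) (x z x' z' : 'rV[R]_n) :=
  let y := (1 - t) *: x + t *: z in
  [/\ forall i, i \in A -> is_argmin (update_model tau f psi v t i y z) (z' ord0 i),
      forall i, i \notin A -> z' ord0 i = z ord0 i &
      x' = y + (n%:R / tau * t) *: (z' - z)].

Lemma update_model_argmin_proper t i (y z : 'rV[R]_n) u : 0 < t ->
  is_argmin (update_model tau f psi v t i y z) u -> psi i u \is a fin_num.
Proof.
move=> t0 am.
have b0 : 0 <= t * n%:R * v ord0 i / (2 * tau).
  by rewrite divr_ge0 ?mulr_ge0 ?ler0n// ltW.
by have [] := argmin_three_point b0 (psi_ninfty i) (psi_cc i) (xs_proper i) am.
Qed.

Lemma update_model_argmin_unique t i (y z : 'rV[R]_n) u u' : 0 < t ->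
  is_argmin (update_model tau f psi v t i y z) u ->
  is_argmin (update_model tau f psi v t i y z) u' -> u = u'.
Proof.
move=> t0; apply: argmin_unique => //; last by exists (xs ord0 i); exact: xs_proper.
by rewrite divr_gt0 ?mulr_gt0 ?ltr0n.
Qed.

Lemma approx_step_functional t A x z x1 z1 x2 z2 : 0 < t ->
  approx_step t A x z x1 z1 -> approx_step t A x z x2 z2 -> x1 = x2 /\ z1 = z2.
Proof.
move=> t0 [a1 b1 ->] [a2 b2 ->]; suff -> : z1 = z2 by [].
apply/rowP => i; have [iA|iA] := boolP (i \in A); last by rewrite b1// b2.
by apply: update_model_argmin_unique (a1 _ iA) (a2 _ iA).
Qed.

Lemma approx_step_proper t A x z x' z' : 0 < t ->
  approx_step t A x z x' z' -> proper z -> proper z'.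
Proof.
move=> t0 [a b _] pz i; have [iA|iA] := boolP (i \in A); last by rewrite b.
exact: update_model_argmin_proper (a _ iA).
Qed.

Let vth_gt0 i : 0 < vth i := vartheta_gt0 th0_gt0 i.

(** * One epoch: [J] steps from iteration [s] on, before any replacement *)

Section iterates.
Context (s J : nat) (x z : nat -> T -> 'rV[R]_n).
Hypothesis x0z0 : x 0 = z 0.
Hypothesis x0_proper : forall w, proper (x 0 w).
Hypothesis x0_adapted : adapted S s (x 0).
Hypothesis xz_step : forall i w, (i < J)%N ->
  approx_step (vth i) (S (s + i) w) (x i w) (z i w) (x i.+1 w) (z i.+1 w).

Lemma epoch_adapted i : (i <= J)%N ->
  adapted S (s + i) (x i) /\ adapted S (s + i) (z i).
Proof.
elim: i => [|i ih] iJ; first by rewrite addn0 -x0z0.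
have [ax az] := ih (ltnW iJ); rewrite addnS.
have ad w w' : history S (s + i).+1 w = history S (s + i).+1 w' ->
    x i.+1 w = x i.+1 w' /\ z i.+1 w = z i.+1 w'.
  rewrite /history !mkseqS => /rcons_inj[hw Sw].
  have := xz_step w' iJ; rewrite -(ax _ _ hw) -(az _ _ hw) -Sw.
  exact: approx_step_functional (xz_step w iJ).
by split => w w' /ad[].
Qed.

Lemma epoch_z_proper i w : (i <= J)%N -> proper (z i w).
Proof.
elim: i => [|i ih] iJ; first by rewrite -x0z0.
exact: approx_step_proper (xz_step w iJ) (ih (ltnW iJ)).
Qed.

Lemma epoch_x_average i w : (i <= J)%N ->
  x i w = \sum_(l < i.+1) g i l *: z l w.
Proof.
elim: i => [|i ih] iJ.
  by rewrite big_ord_recr big_ord0 /= add0r scale1r x0z0.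
have [_ _ ->] := xz_step w iJ.
rewrite (gamma_rec th0_gt0 (fun l => z l w)) -ih ?(ltnW iJ)//.
rewrite scalerBr scalerBl -!addrA; congr (_ + _).
by congr (_ + _); rewrite addrCA -scalerBl.
Qed.

Let gamma_convex i (phi : 'rV[R]_n -> R) w : (i <= J)%N ->
  (forall a b t, proper a -> proper b -> 0 <= t <= 1 ->
    phi (t *: a + (1 - t) *: b) <= t * phi a + (1 - t) * phi b) ->
  proper (x i w) /\ phi (x i w) <= \sum_(l < i.+1) g i l * phi (z l w).
Proof.
move=> iJ cphi; rewrite epoch_x_average//.
apply: (jensen _ (c := g i) (a := fun l => z l w)).
- move=> a b t pa pb t01; split; last exact: cphi.
  exact: proper_point_convex.
- by move=> l _; exact: gamma_ge0.
- exact: gamma_sum1.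
- by move=> l; rewrite ltnS => /leq_trans/(_ iJ); exact: epoch_z_proper.
Qed.

Lemma epoch_x_proper i w : (i <= J)%N -> proper (x i w).
Proof.
by move=> iJ; have [] := gamma_convex w iJ (fpsi_convex psi_ninfty psi_cc).
Qed.

(** Unlike [Psi] at [x i], which it bounds from above, this is linear in the values of [Psi] at the
    points [z l], so [mean_partial_update] gives its conditional mean exactly. *)
Definition psi_hat i w := \sum_(l < i.+1) g i l * Psi (z l w).

Lemma fpsi_le_psi_hat i w : (i <= J)%N -> Psi (x i w) <= psi_hat i w.
Proof.
by move=> iJ; have [] := gamma_convex w iJ (fpsi_convex psi_ninfty psi_cc).
Qed.

Lemma epoch_x_dist i w : (i <= J)%N ->
  wnorm2 v (x i w - xs) <= \sum_(l < i.+1) g i l * wnorm2 v (z l w - xs).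
Proof.
move=> iJ.
have [] // := gamma_convex (phi := fun a => wnorm2 v (a - xs)) w iJ.
by move=> a b t _ _; exact: dist_convex.
Qed.

Definition lyapunov i w :=
  inv2 i * (f (x i w) + psi_hat i w - F xs) +
  (2 * th0 ^+ 2)^-1 * wnorm2 v (z i w - xs).

Lemma lyapunov0 : lyapunov 0 = (fun w => pot (x 0 w)).
Proof.
apply/funext => w; rewrite /lyapunov /psi_hat big_ord_recr big_ord0 /= add0r mul1r.
by rewrite x0z0.
Qed.

(** Otherwise the marginal [th0] of coordinate [l] would be 0. *)
Lemma exists_draw l : exists A, 0 < q A /\ l \in A.
Proof.
have [//|noA] := pselect (exists A, 0 < q A /\ l \in A).
suff : th0 = 0 by move=> h; move: th0_gt0; rewrite h ltxx.
rewrite -(q_marginal l); apply: big1 => A _.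
have [lA|] := boolP (l \in A); last by rewrite mulr0.
have [qA|qA] := ltP 0 (q A); first by case: noA; exists A.
have -> : q A = 0 by apply/eqP; rewrite eq_le qA q_ge0.
by rewrite mul0r.
Qed.

Lemma mean_lyapunovS i : (i < J)%N ->
  EE (s + i).+1 (lyapunov i.+1) <= EE (s + i) (lyapunov i).
Proof.
move=> iJ; apply: (mean_step q_ge0 witP) => w e _ he.
have heq A : 0 < q A -> history S (s + i) (e A) = history S (s + i) w /\
    S (s + i) (e A) = A.
  by move=> /he; rewrite /history mkseqS => /rcons_inj[].
(* For each coordinate [l], take a set of positive weight containing it. The run under that draw
   exhibits the minimiser in coordinate [l], and [u] glues these minimisers together. *)
have [draw drawP] := choice exists_draw.
pose u : 'rV[R]_n := \row_l z i.+1 (e (draw l)) ord0 l.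
have xe A l : 0 < q A -> (l <= i)%N -> x l (e A) = x l w /\ z l (e A) = z l w.
  move=> /heq[hA _] li; have [ax az] := epoch_adapted (leq_trans li (ltnW iJ)).
  by split; [apply: ax|apply: az]; apply: history_le hA; rewrite leq_add2l.
have step A : 0 < q A ->
    approx_step (vth i) A (x i w) (z i w) (x i.+1 (e A)) (z i.+1 (e A)).
  move=> qA; have [xA zA] := xe A i qA (leqnn i); have [_ SA] := heq A qA.
  by have := xz_step (e A) iJ; rewrite xA zA SA.
have am l : is_argmin (update_model tau f psi v (vth i) l
    ((1 - vth i) *: x i w + vth i *: z i w) (z i w)) (u ord0 l).
  by have [qd ld] := drawP l; have [a _ _] := step _ qd; rewrite mxE; exact: a.
(* By uniqueness of minimisers, every draw of positive weight takes its sampled coordinates from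
   this same [u]. *)
have zA A : 0 < q A -> z i.+1 (e A) = partial_update A u (z i w).
  move=> /step[a b _]; apply/rowP => l; rewrite [RHS]mxE.
  case: ifPn => lA; last exact: b.
  exact: update_model_argmin_unique (a _ lA) (am l).
have psiA A : 0 < q A -> psi_hat i.+1 (e A) = (1 - vth i) * psi_hat i w +
    n%:R / tau * vth i * Psi (partial_update A u (z i w)) +
    (vth i - n%:R / tau * vth i) * Psi (z i w).
  move=> qA; rewrite /psi_hat.
  have := gamma_rec th0_gt0 (fun l => Psi (z l (e A)) : R^o) i.
  rewrite zA// (xe A i qA (leqnn i)).2 => ->; congr (_ * _ + _ + _).
  apply: eq_bigr => l _; by rewrite (xe A l qA _).2// -ltnS.
rewrite {2}/lyapunov inv_prev2E//.
have v01 : 0 < vth i <= 1 by rewrite vth_gt0 vartheta_le1.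
apply: le_trans (approx_step_descent f_convex f_diff psi_ninfty psi_cc v_gt0 tau_gt0
  n_gt0 q_sum1 q_marginal q_eso (psi_hat i w) v01 xs_proper am).
rewrite le_eqVlt; apply/orP; left; apply/eqP; apply: eq_bigr => A _.
have [qA|qA] := ltP 0 (q A); last first.
  have -> : q A = 0 by apply/eqP; rewrite eq_le qA q_ge0.
  by rewrite !mul0r.
rewrite /lyapunov psiA// zA//; have [_ _ ->] := step A qA.
by rewrite zA// [inv2 _ * _]mulrC.
Qed.

Definition start_potential := EE s (fun w => pot (x 0 w)).

Lemma mean_lyapunov_le i : (i <= J)%N -> EE (s + i) (lyapunov i) <= start_potential.
Proof.
elim: i => [|i ih] iJ; first by rewrite addn0 lyapunov0.
by rewrite addnS; apply: le_trans (mean_lyapunovS iJ) (ih (ltnW iJ)).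
Qed.

Lemma lyapunov_adapted i : (i <= J)%N -> adapted S (s + i) (lyapunov i).
Proof.
move=> iJ w w' hw; have [ax az] := epoch_adapted iJ.
rewrite /lyapunov /psi_hat (ax _ _ hw) (az _ _ hw).
congr (_ * (_ + _ - _) + _); apply: eq_bigr => l _.
have li : (l <= i)%N by rewrite -ltnS.
have [_ azl] := epoch_adapted (leq_trans li iJ).
by rewrite (azl w w')//; apply: history_le hw; rewrite leq_add2l.
Qed.

(** Index [j] is the newest iterate, with weight [last_weight]; the restart average becomes a single
    convex combination over the indices up to [j]. *)
Definition avg_weight j i :=
  (if (i < j)%N then g j i * inv2 i else last_weight n tau j) / W_coef n tau j.

Lemma sum_avg_weight j (V : lmodType R) (a : nat -> V) :
  \sum_(i < j.+1) avg_weight j i *: a i = (W_coef n tau j)^-1 *: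
    (\sum_(i < j) (g j i * inv2 i) *: a i + last_weight n tau j *: a j).
Proof.
rewrite scalerDr scaler_sumr big_ord_recr /= {2}/avg_weight ltnn.
congr (_ + _); last by rewrite scalerA mulrC.
by apply: eq_bigr => i _; rewrite /avg_weight ltn_ord scalerA mulrC.
Qed.

Lemma avg_weight_ge0 j i : 0 <= avg_weight j i.
Proof.
have W0 := W_coef_gt0 th0_gt0 theta0_le1 j.
apply: divr_ge0 (ltW W0); case: ifP => _; last exact/ltW/last_weight_gt0.
by rewrite mulr_ge0 ?gamma_ge0 ?inv_prev2_ge0.
Qed.

Lemma avg_weight_sum1 j : \sum_(i < j.+1) avg_weight j i = 1.
Proof.
have := sum_avg_weight j (fun=> 1 : R^o); rewrite /GRing.scale /=.
under eq_bigr do rewrite mulr1.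
move=> ->; under eq_bigr do rewrite mulr1.
by rewrite mulr1 -/(W_coef n tau j) mulVf// gt_eqF// W_coef_gt0.
Qed.

Definition avg_gap j w := \sum_(i < j.+1) avg_weight j i * (F (x i w) - F xs).

Lemma avg_gap_ge0 j w : (j <= J)%N -> 0 <= avg_gap j w.
Proof.
move=> jJ; apply: sumr_ge0 => i _; rewrite mulr_ge0 ?avg_weight_ge0// subr_ge0.
by apply: xs_min; apply: epoch_x_proper; apply: leq_trans jJ; rewrite -ltnS.
Qed.

(** In the weighted sum of [lyapunov], [sum_gamma_inv_prev2] detaches the gap term of the potential
    at [x j] from the [W_coef] part. The averaged distances of the points [z i] dominate that of
    their average [x j]. *)
Lemma potential_avg_gap_le j w : (0 < j <= J)%N ->
  pot (x j w) + W_coef n tau j * avg_gap j w <=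
  \sum_(i < j.+1) g j i * lyapunov i w.
Proof.
move=> /andP[j0 jJ]; have W0 := W_coef_gt0 th0_gt0 theta0_le1 j.
have h : \sum_(i < j.+1) g j i * inv2 i * (F (x i w) - F xs) +
    (2 * th0 ^+ 2)^-1 * \sum_(i < j.+1) g j i * wnorm2 v (z i w - xs) <=
    \sum_(i < j.+1) g j i * lyapunov i w.
  rewrite mulr_sumr -big_split; apply: ler_sum => i _ /=.
  rewrite mulrCA -mulrA -mulrDr ler_wpM2l ?gamma_ge0// /lyapunov lerD2r.
  rewrite ler_wpM2l ?inv_prev2_ge0// lerD2r lerD2l fpsi_le_psi_hat//.
  by apply: leq_trans jJ; rewrite -ltnS.
apply: le_trans h; rewrite (sum_gamma_inv_prev2 th0_gt0 (fun i => F (x i w) - F xs) j0) /potential.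
have -> : W_coef n tau j * avg_gap j w =
    \sum_(i < j) g j i * inv2 i * (F (x i w) - F xs) +
    last_weight n tau j * (F (x j w) - F xs).
  have := sum_avg_weight j (fun i => F (x i w) - F xs : R^o).
  by rewrite /avg_gap /GRing.scale /= => ->; rewrite mulrA divff ?mul1r// gt_eqF.
have [_ c2] := potential_coef_ge0 theta0_le1.
have := ler_wpM2l c2 (epoch_x_dist w jJ); lra.
Qed.

(** Each [lyapunov i] depends on the first [s + i] draws only, so its mean at time [s + j] is the
    earlier one, bounded by the start; the weights [gamma j i] sum to 1. *)
Lemma mean_potential_avg_gap j : (0 < j <= J)%N ->
  EE (s + j) (fun w => pot (x j w)) + W_coef n tau j * EE (s + j) (avg_gap j) <=
  start_potential.
Proof.
move=> j0J; have /andP[j0 jJ] := j0J.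
rewrite -[X in X + _]mul1r -mean_linear.
apply: le_trans (_ : EE (s + j) (fun w => \sum_(i < j.+1) g j i * lyapunov i w) <= _).
  by apply: (mean_le q_ge0 witP) => w _; rewrite mul1r; exact: potential_avg_gap_le.
rewrite mean_sum -[start_potential]mul1r -(gamma_sum1 th0_gt0 j) mulr_suml.
apply: ler_sum => i _; rewrite ler_wpM2l ?gamma_ge0//.
have ij : (i <= j)%N by rewrite -ltnS.
rewrite (@mean_adapted _ _ _ q_ge0 q_sum1 _ S _ witP (s + i)) ?leq_add2l//.
  exact: mean_lyapunov_le (leq_trans ij jJ).
exact: lyapunov_adapted (leq_trans ij jJ).
Qed.

Lemma mean_potential_le j : (j <= J)%N ->
  EE (s + j) (fun w => pot (x j w)) <= start_potential.
Proof.
case: j => [|j] jJ; first by rewrite addn0.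
apply: le_trans (mean_potential_avg_gap (j := j.+1) _); last by rewrite jJ.
rewrite lerDl mulr_ge0 ?(ltW (W_coef_gt0 _ _ _))//.
(* Zero is written as a mean, to be compared with the mean of [avg_gap]. *)
have -> : 0 = EE (s + j.+1) (fun w => 0 * avg_gap j.+1 w + 0 * avg_gap j.+1 w).
  by rewrite mean_linear !mul0r addr0.
by apply: (mean_le q_ge0 witP) => w _; rewrite !mul0r addr0; exact: avg_gap_ge0.
Qed.

Definition epoch_average j w := \sum_(i < j.+1) avg_weight j i *: x i w.

Let average_convex j (phi : 'rV[R]_n -> R) w : (j <= J)%N ->
  (forall a b t, proper a -> proper b -> 0 <= t <= 1 ->
    phi (t *: a + (1 - t) *: b) <= t * phi a + (1 - t) * phi b) ->
  proper (epoch_average j w) /\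
  phi (epoch_average j w) <= \sum_(i < j.+1) avg_weight j i * phi (x i w).
Proof.
move=> jJ cphi; apply: (jensen _ (c := avg_weight j) (a := fun l => x l w)).
- move=> a b t pa pb t01; split; last exact: cphi.
  exact: proper_point_convex.
- by move=> l _; exact: avg_weight_ge0.
- exact: avg_weight_sum1.
- by move=> l; rewrite ltnS => /leq_trans/(_ jJ); exact: epoch_x_proper.
Qed.

Lemma epoch_average_proper j w : (j <= J)%N -> proper (epoch_average j w).
Proof.
by move=> jJ; have [] := average_convex w jJ (fpsi_convex psi_ninfty psi_cc).
Qed.

Lemma mean_potential_average j : (j <= J)%N ->
  EE (s + j) (fun w => pot (epoch_average j w)) <= start_potential.
Proof.
move=> jJ; apply: le_trans (_ : EE (s + j) (fun w =>
    \sum_(i < j.+1) avg_weight j i * pot (x i w)) <= _).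
  apply: (mean_le q_ge0 witP) => w _.
  by have [] := average_convex w jJ (potential_convex xs f_convex psi_ninfty
    psi_cc v_gt0 theta0_le1).
rewrite (mean_sum _ _ _ _ _ (fun i w => pot (x i w))) -[start_potential]mul1r -(avg_weight_sum1 j) mulr_suml.
apply: ler_sum => i _; rewrite ler_wpM2l ?avg_weight_ge0//.
have ij : (i <= j)%N by rewrite -ltnS.
rewrite (@mean_adapted _ _ _ q_ge0 q_sum1 _ S _ witP (s + i)) ?leq_add2l//.
  exact: mean_potential_le (leq_trans ij jJ).
move=> w w' hw; have [ax _] := epoch_adapted (leq_trans ij jJ).
by rewrite (ax w w').
Qed.

(** By Jensen the gap at the average point is at most [avg_gap], and [m_coef_potential] bounds
    [W_coef] times this gap from below by a multiple of the potential. *)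
Lemma m_coef_mean_average j : (0 < j <= J)%N ->
  EE (s + j) (fun w => pot (x j w)) +
  m_coef n tau j mu * EE (s + j) (fun w => pot (epoch_average j w)) <=
  start_potential.
Proof.
move=> j0J; have /andP[j0 jJ] := j0J.
apply: le_trans (mean_potential_avg_gap j0J).
rewrite -[X in X + _ <= _]mul1r -[X in _ <= X + _]mul1r -!mean_linear.
apply: (mean_le q_ge0 witP) => w _; rewrite !mul1r lerD2l.
apply: le_trans (m_coef_potential mu_gt0 th0_gt0 theta0_le1 F_strong j
  (epoch_average_proper w jJ)) _.
rewrite ler_wpM2l ?(ltW (W_coef_gt0 _ _ _))//.
have [_ h] := average_convex w jJ (fobj_convex f_convex psi_ninfty psi_cc).
rewrite lerBlDr; apply: le_trans h _; rewrite /avg_gap.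
rewrite -[X in _ <= _ + X]mul1r -(avg_weight_sum1 j) mulr_suml -big_split /=.
by apply: ler_sum => i _; rewrite mulrBr subrK.
Qed.

(* When [1 - sigma <= sigma * m], the bound is [sigma] times the previous lemma;
   otherwise [1 - sigma - sigma * m > 0] multiplies the bound by the potential
   at the average point. *)
Lemma mean_potential_restart j (sigma : R) : (0 < j <= J)%N -> 0 < sigma < 1 ->
  EE (s + j) (fun w => pot (sigma *: x j w + (1 - sigma) *: epoch_average j w)) <=
  Num.max sigma (1 - sigma * m_coef n tau j mu) * start_potential.
Proof.
move=> j0J /andP[sg0 sg1]; have /andP[j0 jJ] := j0J.
apply: le_trans (_ : sigma * EE (s + j) (fun w => pot (x j w)) +
   (1 - sigma) * EE (s + j) (fun w => pot (epoch_average j w)) <= _).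
  rewrite -mean_linear; apply: (mean_le q_ge0 witP) => w _.
  apply: potential_convex => //.
  - exact: epoch_x_proper.
  - exact: epoch_average_proper.
  - by rewrite !ltW.
have h1 := m_coef_mean_average j0J; have h2 := mean_potential_average jJ.
have nonneg (a : T -> 'rV[R]_n) : (forall w, proper (a w)) ->
    0 <= EE (s + j) (fun w => pot (a w)).
  move=> pa.
  have -> : 0 = EE (s + j) (fun w => 0 * pot (a w) + 0 * pot (a w)).
    by rewrite mean_linear !mul0r addr0.
  by apply: (mean_le q_ge0 witP) => w _; rewrite !mul0r addr0; exact: potential_ge0.
have B0 := nonneg _ (fun w => epoch_average_proper w jJ).
have A0 := nonneg _ (fun w => epoch_x_proper w jJ).
move: h1 h2 B0 A0; set A := EE _ _; set B := EE _ _.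
set m := m_coef _ _ _ _; set D := start_potential => h1 h2 B0 A0.
have D0 : 0 <= D by exact: le_trans B0 h2.
have h1' := ler_wpM2l (ltW sg0) h1.
have [le|lt] := leP (1 - sigma) (sigma * m).
  apply: le_trans (_ : sigma * D <= _); last by rewrite ler_wpM2r// le_max lexx.
  have := ler_wpM2r B0 le; lra.
apply: le_trans (_ : (1 - sigma * m) * D <= _).
  have lt0 : 0 <= 1 - sigma - sigma * m by rewrite subr_ge0 ltW.
  have := ler_wpM2l lt0 h2; lra.
by rewrite ler_wpM2r// le_max lexx orbT.
Qed.

End iterates.

(** * The run as a succession of epochs *)

Section run.
Context (K : nat) (sigma : R) (x0 : 'rV[R]_n) (x z xn zn : nat -> T -> 'rV[R]_n).
Hypothesis K_gt0 : (0 < K)%N.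
Hypothesis sigma01 : 0 < sigma < 1.
Hypothesis x0_proper : proper x0.
Hypothesis run_x0 : forall w, x 0 w = x0.
Hypothesis run_z0 : forall w, z 0 w = x0.
Hypothesis run_step : forall k w,
  approx_step (theta n tau K k) (S k w) (x k w) (z k w) (xn k w) (zn k w).
Hypothesis run_xS : forall k w, x k.+1 w =
  if (K %| k)%N then restart_point tau K sigma (x^~ w) k (xn k w) else xn k w.
Hypothesis run_zS : forall k w, z k.+1 w =
  if (K %| k)%N then restart_point tau K sigma (x^~ w) k (xn k w) else zn k w.

Local Notation lr := (last_restart K).
Local Notation len k := (k.+1 - lr k)%N.

(* The iterates of the epoch starting at [s], before any replacement. *)
Definition epoch_x s i := if i is i'.+1 then xn (s + i') else x s.
Definition epoch_z s i := if i is i'.+1 then zn (s + i') else z s.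

(** None of the iterations from [lr k] up to but excluding [k] is a multiple of [K], so nothing has
    been replaced since the epoch began. *)
Lemma epoch_iterateE k i w : (lr k + i <= k)%N ->
  epoch_x (lr k) i w = x (lr k + i) w /\ epoch_z (lr k) i w = z (lr k + i) w.
Proof.
case: i => [|i]; first by rewrite addn0.
rewrite addnS run_xS run_zS => ik.
by rewrite (@last_restart_ndvd _ k) ?leq_addr.
Qed.

Lemma epoch_startE k : epoch_x (lr k) 0 = epoch_z (lr k) 0.
Proof.
apply/funext => w /=; elim: k => [|k ih] /=; first by rewrite run_x0 run_z0.
by case: ifP => // Kk; rewrite run_xS run_zS Kk.
Qed.

Lemma lr_len k : (lr k + len k)%N = k.+1.
Proof. by rewrite subnKC// leqW// last_restart_le. Qed.

Lemma len_gt0 k : (0 < len k)%N.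
Proof. by rewrite subn_gt0 ltnS last_restart_le. Qed.

Lemma epoch_step k i w : (i < len k)%N ->
  approx_step (vth i) (S (lr k + i) w) (epoch_x (lr k) i w) (epoch_z (lr k) i w)
    (epoch_x (lr k) i.+1 w) (epoch_z (lr k) i.+1 w).
Proof.
rewrite ltn_subRL ltnS => ik; have [-> ->] := epoch_iterateE w ik.
have := run_step (lr k + i) w.
rewrite theta_vartheta (@last_restart_const _ k) ?leq_addr//.
by rewrite addKn.
Qed.

Lemma epoch_lastE k w : epoch_x (lr k) (len k) w = xn k w.
Proof.
rewrite subSn ?last_restart_le//= subnKC//; exact: last_restart_le.
Qed.

Lemma restart_pointE k w : restart_point tau K sigma (x^~ w) k (xn k w) =
  sigma *: epoch_x (lr k) (len k) w +
  (1 - sigma) *: epoch_average (epoch_x (lr k)) (len k) w.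
Proof.
rewrite epoch_lastE /restart_point; congr (_ + _ *: _).
rewrite /average_point /epoch_average.
rewrite (sum_avg_weight _ (fun i => epoch_x (lr k) i w)) epoch_lastE.
congr (_ *: (_ + _)); apply: eq_bigr => i _.
have [|-> //] := @epoch_iterateE k i w.
by have := ltn_ord i; rewrite ltn_subRL ltnS.
Qed.

(** Strong induction goes back to the last restart, where the epoch lemmas take over, because the
    restart average involves all iterates of the epoch. *)
Lemma run_proper_adapted k :
  (forall w, proper (x k w)) /\ adapted S k (x k).
Proof.
elim/ltn_ind: k => -[|k] ih.
  by split => [w|w w' _]; rewrite ?run_x0.
have [px ax] := ih _ (last_restart_le K k : (_ < k.+1)%N).
have pE i w : (i <= len k)%N -> proper (epoch_x (lr k) i w).
  exact: epoch_x_proper (epoch_startE k) px (@epoch_step k) i w.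
have aE i : (i <= len k)%N -> adapted S (lr k + i) (epoch_x (lr k) i).
  by move=> il; have [] := epoch_adapted (epoch_startE k) ax (@epoch_step k) il.
split=> [w|w w' hw]; rewrite !run_xS.
  case: ifP => _; last by rewrite -epoch_lastE; exact: pE.
  rewrite restart_pointE; apply: proper_point_convex => //.
  - exact: pE.
  - exact: epoch_average_proper (epoch_startE k) px (@epoch_step k) (len k) w _.
  - by case/andP: sigma01 => s0 s1; rewrite !ltW.
have aE' i : (i <= len k)%N -> epoch_x (lr k) i w = epoch_x (lr k) i w'.
  move=> il; apply: aE => //; apply: history_le hw.
  by rewrite -(lr_len k) leq_add2l.
case: ifP => _; last by rewrite -!epoch_lastE aE'.
rewrite !restart_pointE aE'//; congr (_ + _ *: _).
by apply: eq_bigr => i _; rewrite aE'// -ltnS.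
Qed.

Definition run_potential k := EE k (fun w => pot (x k w)).

Local Notation rate j := (Num.max sigma (1 - sigma * m_coef n tau j mu)).

Lemma run_potential_restart k : (K %| k)%N ->
  run_potential k.+1 <= rate (len k) * run_potential (lr k).
Proof.
move=> Kk; have [px ax] := run_proper_adapted (lr k).
have := mean_potential_restart (epoch_startE k) px ax (@epoch_step k)
  (j := len k) _ sigma01; rewrite len_gt0 leqnn lr_len => /(_ isT).
apply: le_trans; rewrite le_eqVlt; apply/orP; left; apply/eqP.
by congr (mean _ _ _ _); apply/funext => w; rewrite run_xS Kk restart_pointE.
Qed.

Lemma run_potential_no_restart k : (K %| k)%N = false ->
  run_potential k.+1 <= run_potential (lr k).
Proof.
move=> Kk; have [px ax] := run_proper_adapted (lr k).
have := mean_potential_le (epoch_startE k) px ax (@epoch_step k) (leqnn _).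
rewrite lr_len; apply: le_trans; rewrite le_eqVlt; apply/orP; left; apply/eqP.
by congr (mean _ _ _ _); apply/funext => w; rewrite run_xS Kk epoch_lastE.
Qed.

Lemma rate_gt0 j : 0 < rate j.
Proof. by rewrite lt_max; case/andP: sigma01 => ->. Qed.

Lemma rate_le1 j : rate j <= 1.
Proof.
case/andP: sigma01 => s0 s1; rewrite ge_max (ltW s1)/= lerBlDr lerDl.
by rewrite mulr_ge0// ltW// m_coef_gt0.
Qed.

Lemma run_potential0 : run_potential 0 = pot x0.
Proof. by rewrite /run_potential /mean /= run_x0. Qed.

Lemma run_potential_restarts m :
  run_potential (m * K).+1 <= rate K ^+ m * pot x0.
Proof.
have p0 : 0 <= pot x0 by exact: potential_ge0.
elim: m => [|m ih].
  (* The first epoch has one iteration, so its factor contains [m_coef] at 1 instead of [K]; it is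
     only bounded by 1. *)
  rewrite mul0n expr0 mul1r -run_potential0.
  apply: le_trans (run_potential_restart (dvdn0 K)) _.
  by rewrite /= ler_piMl ?rate_le1// run_potential0.
apply: le_trans (run_potential_restart (dvdn_mull _ (dvdnn K))) _.
have -> : lr (m.+1 * K) = (m * K).+1.
  by rewrite mulSn addnC -{3}(prednK K_gt0) last_restartE// prednK.
rewrite subSS mulSn addnK exprS -mulrA ler_wpM2l//.
by rewrite ltW// rate_gt0.
Qed.

Lemma run_potential_bound k : (K <= k)%N ->
  run_potential k <= (rate K `^ (K%:R^-1)) ^+ (k - K) * pot x0.
Proof.
move=> Kk; have k0 : (0 < k)%N := leq_trans K_gt0 Kk.
(* Dividing [k.-1] fits epochs that start at [m * K + 1]: after the initial one, [m] epochs of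
   length [K] are complete at time [k]. *)
pose m := (k.-1 %/ K)%N; pose r := (k.-1 %% K)%N.
have rK : (r < K)%N by rewrite ltn_mod.
have kE : k = (m * K + r).+1 by rewrite -divn_eq prednK.
have p0 : 0 <= pot x0 by exact: potential_ge0.
apply: le_trans (_ : run_potential (m * K).+1 <= _).
  rewrite {1}kE; case: r rK {kE} => [|r] rK; first by rewrite addn0.
  rewrite -(last_restartE m (ltnW rK)); apply: run_potential_no_restart.
  by rewrite dvdn_addr ?dvdn_mull// gtnNdvd.
apply: le_trans (run_potential_restarts m) _; rewrite ler_wpM2r//.
set a := rate K `^ _.
have aK : a ^+ K = rate K.
  rewrite /a -powR_mulrn ?powR_ge0// -powRrM mulVf ?pnatr_eq0 -?lt0n//.
  by rewrite powRr1// ltW// rate_gt0.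
(* The base is at most 1, and [k - K <= m * K] because [r < K]. *)
rewrite -aK -exprM mulnC; apply: ler_wiXn2l; first exact: powR_ge0.
  rewrite -(@expr_le1 _ K)// ?powR_ge0// aK; exact: rate_le1.
by rewrite leq_subLR kE addnC; lia.
Qed.

End run.

End algorithm.

(** * The sampling and the objective *)

Section sampling.
Context {R : realType} {n : nat} {d : measure_display} {T : measurableType d}.
Context (P : probability T R) (Shat : {RV P >-> {set 'I_n}}).

Definition draw_prob (A : {set 'I_n}) : R := fine (P (Shat @^-1` [set A])).

Let mShat (B : set {set 'I_n}) : measurable (Shat @^-1` B).
Proof. by rewrite -[X in measurable X]setTI; exact: measurable_funP. Qed.

Lemma draw_prob_ge0 A : 0 <= draw_prob A.
Proof. exact/fine_ge0/measure_ge0. Qed.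

Lemma expectation_draw (g : {set 'I_n} -> R) :
  ('E_P[fun w => g (Shat w)] = (\sum_A draw_prob A * g A)%:E)%E.
Proof.
rewrite unlock (integral_fintype P g (fun u => mShat [set u])).
by congr (_%:E); apply: eq_bigr => A _; rewrite mulrC.
Qed.

Lemma draw_prob_sum1 : \sum_A draw_prob A = 1.
Proof.
have := expectation_draw (fun=> 1); rewrite unlock.
rewrite -[X in X = _ -> _]/(\int[P]_w (cst 1%:E w))%E.
rewrite integral_cst//= probability_setT mule1 => -[->].
by apply: eq_bigr => A _; rewrite mulr1.
Qed.

(** Uniformity makes the [n] marginals equal, and they add up to the mean cardinality [tau]. *)
Lemma draw_prob_marginal tau : uniform_sampling Shat -> (0 < n)%N ->
  ('E_P[fun w => (#|Shat w|%:R)%R] = tau%:E)%E ->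
  forall i, \sum_A draw_prob A * (i \in A)%:R = theta0 n tau.
Proof.
move=> unif n0; rewrite (expectation_draw (fun A => #|A|%:R)) => -[<-] i.
have marg j : \sum_A draw_prob A * (j \in A)%:R = fine (P [set w | j \in Shat w]).
  have := expectation_draw (fun A => (j \in A)%:R); rewrite unlock => h.
  rewrite -[LHS]/(fine (_%:E)) -h.
  have -> : [set w | j \in Shat w] = Shat @^-1` [set A : {set 'I_n} | j \in A] by [].
  rewrite -[Shat @^-1` _]setIT -integral_indic//.
  by congr fine; apply: eq_integral => w _; rewrite indicE; congr (_%:R%:E); rewrite mem_setE.
have -> : \sum_A draw_prob A * #|A|%:R =
    \sum_(j < n) \sum_A draw_prob A * (j \in A)%:R.
  rewrite exchange_big; apply: eq_bigr => A _ /=.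
  by rewrite -mulr_sumr -natr_sum -sum1_card big_mkcond.
under [X in theta0 _ X]eq_bigr => j _ do rewrite marg (unif j i) -marg.
by rewrite sumr_const card_ord /theta0 -[_ *+ n]mulr_natr mulfK// pnatr_eq0 -lt0n.
Qed.

(** For [n = 0] every sampled set is empty, so its mean cardinality is 0. *)
Lemma sampled_nonempty tau : ('E_P[fun w => (#|Shat w|%:R)%R] = tau%:E)%E ->
  0 < tau -> (0 < n)%N.
Proof.
rewrite (expectation_draw (fun A => #|A|%:R)) => -[<-].
have [n0|//] := posnP n; rewrite big1 ?ltxx// => A _.
have : (#|A| <= 0)%N by rewrite -n0 -[X in (_ <= X)%N]card_ord max_card.
by rewrite leqn0 => /eqP ->; rewrite mulr0.
Qed.

End sampling.

(** * The extended-valued objective at proper points *)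

Section extended_objective.
Context {R : realType} {n : nat}.
Context (f : 'rV[R]_n -> R) (psi : 'I_n -> R -> \bar R).
Hypothesis psi_ninfty : forall i u, psi i u != -oo%E.

Lemma objective_fobj x : proper_point psi x ->
  objective f psi x = (fobj f psi x)%:E.
Proof.
move=> px; rewrite /objective /fobj EFinD; congr (_ + _)%E.
by rewrite /fpsi -sumEFin; apply: eq_bigr => i _; rewrite fineK.
Qed.

(** A sum without [-oo] terms is [+oo] as soon as one of its terms is. *)
Lemma dom_proper x : dom psi x -> proper_point psi x.
Proof.
rewrite /dom /separable /= => sx i; rewrite fin_numE psi_ninfty /=.
apply/eqP => pi; move: sx; rewrite (bigD1 i)//= pi addye ?ltxx//.
by rewrite esum_eqNy; apply/existsPn => j; rewrite negb_and psi_ninfty orbT.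
Qed.

Lemma objective_lt_dom x : (objective f psi x < +oo)%E -> dom psi x.
Proof. by rewrite /objective /dom /=; case: separable => [r _|//|_]; rewrite ?ltry. Qed.

Lemma Delta_potential tau v xs x : proper_point psi xs -> proper_point psi x ->
  Delta tau (objective f psi) v xs x = (potential tau f psi v xs x)%:E.
Proof. by move=> pxs px; rewrite /Delta !objective_fobj. Qed.

End extended_objective.

Theorem theorem3 (R : realType) (n : nat)
  (f : 'rV[R]_n -> R) (psi : 'I_n -> R -> \bar R)
  (hf_convex : @convex_function R 'rV[R]_n [set: 'rV[R]_n] f)
  (hf_diff : forall x, differentiable f x)
  (hpsi_ninfty : forall i u, psi i u != -oo%E)
  (hpsi : forall i, closed_convex (psi i))
  (F : 'rV[R]_n -> \bar R) (hF : F = objective f psi)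
  (xs : 'rV[R]_n) (hxs : is_minimizer F xs)
  (v : 'rV[R]_n) (hv : forall i, 0 < v ord0 i)
  (mu : R) (hmu : 0 < mu) (hF_strong : strongly_convex_at F v mu xs)
  (d' : measure_display) (T' : measurableType d') (P' : probability T' R)
  (Shat : {RV P' >-> {set 'I_n}})
  (hShat : uniform_sampling Shat)
  (tau : R) (htau : ('E_P'[fun w => (#|Shat w|%:R)%R] = tau%:E)%E)
  (htau_gt0 : 0 < tau)
  (heso : eso Shat f tau v)
  (K : nat) (hK : (1 <= K)%N)
  (sigma : R) (hsigma : 0 < sigma < 1)
  (x0 : 'rV[R]_n) (hx0 : dom psi x0)
  (d : measure_display) (T : measurableType d) (P : probability T R)
  (S : nat -> {RV P >-> {set 'I_n}})
  (hS_law : forall k, same_law (S k) Shat)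
  (hS_indep : mutually_independent S)
  (x z : nat -> T -> 'rV[R]_n)
  (hrun : forall w, approx_restart_run tau K sigma f psi v x0
            (fun k => S k w) (fun k => x k w) (fun k => z k w))
  (k : nat) (hk : (K <= k)%N) :
  (\int[P]_w Delta tau F v xs (x k w) <=
   ((Num.max sigma (1 - sigma * m_coef n tau K mu) `^ (K%:R^-1)) ^+ (k - K))%:E *
   Delta tau F v xs x0)%E.
Proof.
subst F.
have n0 : (0 < n)%N := sampled_nonempty htau htau_gt0.
have px0 : proper_point psi x0 by exact: dom_proper.
(* The minimal value is at most the finite value at [x0]. *)
have pxs : proper_point psi xs.
  apply: dom_proper => //; apply: (@objective_lt_dom _ _ f).
  by apply: le_lt_trans (hxs x0) _; rewrite objective_fobj// ltry.
pose q := draw_prob Shat.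
have marg := draw_prob_marginal hShat n0 htau.
(* [theta0] is the probability that a given coordinate is sampled. *)
have th1 : theta0 n tau <= 1.
  rewrite -(marg (Ordinal n0)) -[X in _ <= X](draw_prob_sum1 Shat); apply: ler_sum => A _.
  by case: (_ \in A); rewrite ?mulr1 ?mulr0 ?draw_prob_ge0.
have xs_min y : proper_point psi y -> fobj f psi xs <= fobj f psi y.
  by move=> py; rewrite -lee_fin -!objective_fobj.
have strong y : proper_point psi y ->
    fobj f psi xs + mu / 2 * wnorm2 v (y - xs) <= fobj f psi y.
  by move=> py; rewrite -lee_fin EFinD -!objective_fobj.
have eso_sum y h : \sum_A q A * f (y + coord_restrict A h) <=
    f y + theta0 n tau *
      (\sum_(i < n) partial_derivative f i y * h ord0 i + 2^-1 * wnorm2 v h).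
  by have := heso y h; rewrite (expectation_draw _ (fun A => f (y + coord_restrict A h))).
have law i A : P (S i @^-1` [set A]) = (q A)%:E.
  have := hS_law i [set A] I; rewrite /distribution /pushforward => ->.
  by rewrite fineK// fin_num_measure// -[X in measurable X]setTI; exact: measurable_funP.
pose hist := history (fun i w => S i w).
(* [point] is a dummy for histories that never occur. The property covers every realised history,
   likely or not, because the integral runs over all outcomes. *)
have /choice[wit witP] (t : seq {set 'I_n}) : exists w' : T,
    (exists w, hist (size t) w = t) -> hist (size t) w' = t.
  have [[w hw]|nw] := pselect (exists w, hist (size t) w = t); first by exists w.
  by exists point => /nw.
have likelyP t : all (fun A => 0 < q A) t -> hist (size t) (wit t) = t.
  by move=> qt; apply: witP; exact: history_realised hS_indep law _ qt.
(* The unreplaced values are chosen separately for each iteration and outcome; uniqueness of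
   minimisers makes the resulting iterates adapted all the same. *)
have /choice[zn znP] (kw : nat * T) : exists znew : 'rV[R]_n,
    let y := extrapolate tau K kw.1 (x kw.1 kw.2) (z kw.1 kw.2) in
    let xnew := y + (n%:R / tau * theta n tau K kw.1) *: (znew - z kw.1 kw.2) in
    [/\ forall i, i \in S kw.1 kw.2 -> is_argmin
          (coord_model tau K f psi v kw.1 i y (z kw.1 kw.2)) (znew ord0 i),
        forall i, i \notin S kw.1 kw.2 -> znew ord0 i = z kw.1 kw.2 ord0 i,
        x kw.1.+1 kw.2 = (if (K %| kw.1)%N then
          restart_point tau K sigma (x^~ kw.2) kw.1 xnew else xnew) &
        z kw.1.+1 kw.2 = (if (K %| kw.1)%N then
          restart_point tau K sigma (x^~ kw.2) kw.1 xnew else znew)].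
  by have [_ _] := hrun kw.2; exact.
pose xnew i w := extrapolate tau K i (x i w) (z i w) +
  (n%:R / tau * theta n tau K i) *: (zn (i, w) - z i w).
have x_0 w : x 0%N w = x0 by have [] := hrun w.
have z_0 w : z 0%N w = x0 by have [] := hrun w.
have step i w : approx_step tau f psi v (theta n tau K i) (S i w) (x i w) (z i w)
    (xnew i w) (zn (i, w)).
  by have [a b _ _] := znP (i, w); split.
have xS i w : x i.+1 w = if (K %| i)%N then
    restart_point tau K sigma (x^~ w) i (xnew i w) else xnew i w.
  by have [_ _ + _] := znP (i, w).
have zS i w : z i.+1 w = if (K %| i)%N then
    restart_point tau K sigma (x^~ w) i (xnew i w) else zn (i, w).
  by have [_ _ _] := znP (i, w).
have [px ax] := run_proper_adapted hpsi_ninfty hpsi hv htau_gt0 n0 th1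
  pxs hsigma px0 x_0 z_0 step xS zS k.
have -> : (\int[P]_w Delta tau (objective f psi) v xs (x k w) =
  (run_potential tau f psi v xs q wit x k)%:E)%E.
  rewrite /run_potential /mean.
  rewrite -(integral_history hS_indep law); apply: eq_integral => w _.
  (* By adaptedness, the iterate at [w] is the one at the witness of its history. *)
  rewrite Delta_potential//; congr (potential _ _ _ _ _ _)%:E; apply: ax.
  by have := witP (hist k w); rewrite size_mkseq => /(_ (ex_intro _ w erefl)).
rewrite Delta_potential// -EFinM lee_fin.
exact: (run_potential_bound hf_convex hf_diff hpsi_ninfty hpsi hv htau_gt0 n0 th1
  hmu pxs xs_min strong (draw_prob_ge0 Shat) (draw_prob_sum1 Shat) marg eso_sum
  likelyP hK hsigma px0 x_0 z_0 step xS zS hk).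
Qed.
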